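(* Let $0<s<1$, $c\in\mathbb{R}$ with $c\neq0$, $m>1$ with $m\neq\frac{1+s}{1-s}$, $\nu_1\in\mathbb{R}\setminus\{0\}$ and $\nu_2\in\{1,-1\}$. Let $\varphi:\mathbb{R}^2\to\mathbb{R}$ be a smooth, vanishing at infinity solution of $$-c\varphi+\nu_1(-\Delta)^s\varphi+\frac{\nu_2}{m}\varphi^m=0 .$$ Then $$\|(-\Delta)^{\frac s2}\varphi\|_{L^2(\mathbb{R}^2)}^2=-\frac{c(m-1)}{\nu_1\,(2-(1-s)(m+1))}\,\|\varphi\|_{L^2(\mathbb{R}^2)}^2,$$ $$\int_{\mathbb{R}^2}\varphi^{m+1}\,dx\,dy=\frac{s\,c\,m(m+1)}{\nu_2\,(2-(1-s)(m+1))}\,\|\varphi\|_{L^2(\mathbb{R}^2)}^2 .$$ As a consequence, when $\nu_1=-1$ and $\nu_2=1$, $$E[\varphi]=r_c\,\frac{c(m-1)}{2\,(2-(1-s)(m+1))}\,\|\varphi\|_{L^2(\mathbb{R}^2)}^2,\qquad r_c=1-\frac{2s}{m-1}.$$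
   Context: $(-\Delta)^s$ is the Fourier multiplier operator with symbol $|\xi|^{2s}$ on $\mathbb{R}^2$. The power $\varphi^m$ is understood for integer $m$ (or for $m-1=k/p$ with $k,p$ relatively prime and $p$ odd, using the branch of $\omega\mapsto\omega^{1/p}$ that is real on the real axis). Energy: $E[\varphi]=\frac12\int_{\mathbb{R}^2}|(-\Delta)^{s/2}\varphi|^2\,dx\,dy+\frac{\nu_2}{\nu_1m(m+1)}\int_{\mathbb{R}^2}\varphi^{m+1}\,dx\,dy$. ''Smooth, vanishing at infinity'' means that $\varphi$ has sufficient regularity and decay: all the integrals involved are finite, the equation may be multiplied by $\varphi$, $x\varphi_x$ and $y\varphi_y$ and integrated over $\mathbb{R}^2$, and the resulting integrations by parts (without boundary terms) and uses of Plancherel's theorem are legitimate. (For instance, this holds for positive solutions in $H^{2s+1}(\mathbb{R}^2)\cap C^\infty(\mathbb{R}^2)$ bounded above and below by multiples of $(1+|(x,y)|^{2+2s})^{-1}$, which exist when $\nu_1<0$, $\nu_2=1$, $c>0$, $1<m<\frac{1+s}{1-s}$.) *)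

(* Defs.v *)
From HB Require Import structures.
From mathcomp Require Import all_boot all_order all_algebra.
From mathcomp Require Import all_classical all_reals all_analysis.

Set Implicit Arguments.
Unset Strict Implicit.
Unset Printing Implicit Defensive.
Import Order.TTheory GRing.Theory Num.Theory.
Import numFieldNormedType.Exports.
Local Open Scope classical_set_scope.
Local Open Scope ring_scope.

Notation plane R := (measurableTypeR R * measurableTypeR R)%type.

(* Kept as a notation so that the sigma-finiteness of the product measure is
   still inferred. *)
Notation leb2 R := ((@lebesgue_measure R) \x (@lebesgue_measure R))%E.

Section Defs.
Context (R : realType).
Implicit Types (u g a b phi : plane R -> R) (s m t : R) (n p k : nat)
  (x xi : plane R).

Definition inL2 u : Prop := u \in Lfun (leb2 R) 2%:E.

Definition L2norm u : R := fine ('N[leb2 R]_(2%:E)[EFin \o u])%E.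

(** * Fourier transform on L^2, with kernel exp(-i x.xi) *)

Definition dotp x xi : R := x.1 * xi.1 + x.2 * xi.2.

Definition box n : set (plane R) :=
  `[- n%:R, n%:R]%classic `*` `[- n%:R, n%:R]%classic.

Definition cos_trunc u n xi : R :=
  \int[leb2 R]_(x in box n) (cos (dotp x xi) * u x).

Definition sin_trunc u n xi : R :=
  \int[leb2 R]_(x in box n) (sin (dotp x xi) * u x).

Definition cvgL2 (f_ : nat -> plane R -> R) (f : plane R -> R) : Prop :=
  ('N[leb2 R]_(2%:E)[EFin \o (f_ n \- f)%R])%E @[n --> \oo] --> 0%E.

(* For real-valued u in L^2(R^2), [is_fourier u a b] says that a + i b is the
   Fourier-Plancherel transform of u: the limit in L^2, as n tends to infinity,
   of the integrals of exp(-i x.xi) u(x) over [-n, n]^2. *)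
Definition is_fourier u a b : Prop :=
  [/\ inL2 u, inL2 a, inL2 b, cvgL2 (cos_trunc u) a &
      cvgL2 (fun n xi => - sin_trunc u n xi) b].

(** * Fractional Laplacian *)

Definition fraclap_symbol s xi : R :=
  Num.sqrt (xi.1 ^+ 2 + xi.2 ^+ 2) `^ (2 * s).

Definition is_fraclap s u g : Prop :=
  exists a b, is_fourier u a b /\
    is_fourier g (fun xi => fraclap_symbol s xi * a xi)
                 (fun xi => fraclap_symbol s xi * b xi).

(* u lies in the L^2-domain of (-Delta)^s, that is in H^{2s}(R^2), for s > 0. *)
Definition fraclap_dom s u : Prop := exists g, is_fraclap s u g.

(* A representative of (-Delta)^s u, which is determined almost everywhere when
   [fraclap_dom s u]; otherwise the value is irrelevant. *)
Definition fraclap s u : plane R -> R := xget (cst 0) [set g | is_fraclap s u g].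

(** * Powers with rational exponents of odd denominator *)

(* The branch of t |-> t^(1/p), p odd, that is real on the real axis. *)
Definition odd_root p t : R := Num.sg t * `|t| `^ (p%:R^-1).

(* t^(n/p); for p = 1 this is the usual power t^n. *)
Definition rat_power n p t : R := odd_root p t ^+ n.

(** * Regularity and decay *)

Definition dx phi x : R := 'D_((1, 0) : plane R) phi x.
Definition dy phi x : R := 'D_((0, 1) : plane R) phi x.

Definition C1 phi : Prop :=
  [/\ forall x, derivable phi x (1, 0), forall x, derivable phi x (0, 1),
      continuous (dx phi) & continuous (dy phi)].

(* The regularity and decay that make it legitimate to multiply the equation by
   phi, x phi_x and y phi_y, to integrate over the plane, and to use Plancherel's
   theorem: phi is C^1 and phi, x phi_x, y phi_y, (-Delta)^s phi and
   (-Delta)^(s/2) phi all belong to L^2.  For a solution of the equation, phi^m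
   is then in L^2 and phi^(m+1) in L^1.  The identities that result from
   integrating by parts and from Plancherel's theorem are not assumed. *)
Definition smooth_vanishing s phi : Prop :=
  [/\ C1 phi,
      inL2 (fun x => x.1 * dx phi x), inL2 (fun x => x.2 * dy phi x),
      fraclap_dom s phi & fraclap_dom (s / 2) phi].

(** * Equation and energy *)

(* In the next two definitions m - 1 = k / p, so that phi^m is phi^((p + k) / p)
   and phi^(m + 1) is phi^((2 p + k) / p). *)
Definition is_solution s c nu1 nu2 m k p phi : Prop :=
  {ae leb2 R, forall x, - c * phi x + nu1 * fraclap s phi x
     + nu2 / m * rat_power (p + k) p (phi x) = 0}.

Definition energy s nu1 nu2 m k p phi : R :=
  2^-1 * (\int[leb2 R]_x (`|fraclap (s / 2) phi x| ^+ 2))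
  + nu2 / (nu1 * m * (m + 1))
    * (\int[leb2 R]_x (rat_power (2 * p + k) p (phi x))).

End Defs.

(* Main.v *)
Require Import Defs.
From HB Require Import structures.
From mathcomp Require Import all_boot all_order all_algebra.
From mathcomp Require Import all_classical all_reals all_analysis.
From mathcomp Require Import measurable_realfun ring lra.

Set Implicit Arguments.
Unset Strict Implicit.
Unset Printing Implicit Defensive.
Import Order.TTheory GRing.Theory Num.Theory.
Import numFieldNormedType.Exports.
Local Open Scope classical_set_scope.
Local Open Scope ring_scope.

(** Let [A], [B] and [P] be the integrals of [phi^2], of [|(-Delta)^(s/2) phi|^2]
    and of [phi^(m+1)], let [g = (-Delta)^s phi], and let
    [D = x phi_x + y phi_y] be the radial derivative of [phi]. Testing the
    equation with [phi] and with [D] gives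

      - c A + nu1 B + (nu2 / m) P = 0,
      - c <phi, D> + nu1 <g, D> + (nu2 / m) <phi^m, D> = 0.

    The first relation uses [<g, phi> = B], which is Parseval's identity
    ([fraclap_energy]). In the second one,

      <phi, D> = - A,   <phi^m, D> = - 2 P / (m + 1),   <g, D> = - (1 - s) B.

    What remains is a linear system for [B] and [P] ([virial_system]), regular
    because [m] is not the critical exponent, and the energy is a combination of
    [B] and [P].

    The first two products integrate [phi D] and [phi^m D], the radial derivatives
    of [phi^2 / 2] and of [phi^(m+1) / (m + 1)]. The integral of a radial
    derivative [x . grad psi] is [- 2] times that of [psi]. Only the
    integrability of the two functions is known, so no boundary terms are
    discussed: one integrates the derivative of [t^2 psi(t x)] over [1 < t < 2]
    and over [x] in both orders ([radial_int]).

    The third product is the Pohozaev identity ([fraclap_pohozaev]). The symbol of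
    [(-Delta)^s] is homogeneous of degree [2 s], so that
    [F c = <g, phi (c .)>] satisfies [F (1/c) = c^(2 - 2 s) F c]
    ([fraclap_dil]), and the identity is the derivative of this relation at
    [c = 1]. The function [F] is differentiable there with derivative [<g, D>]:
    the difference quotients of [c |-> phi (c .)] are bounded in L^2 by the norm
    of [D] ([radial_L2]) and converge pointwise, hence weakly ([weak_cvg]).

    Parseval's identity is needed only up to a positive factor, and is obtained as
    follows. For intervals it reduces to
    [int (1 - cos (t x)) / x^2 dx = C |t|], which follows from a change of variable
    ([int_kcos], [cos_sin_itv_ip]); products of intervals give rectangles
    ([rect_plancherel]). It extends to the square-integrable functions supported in
    a square because linear combinations of rectangles are dense there
    ([step_closure_L2], a Dynkin system argument) and the transform passes to the
    limit by Fatou's lemma ([step_closure_seq]). Truncation to growing squares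
    finally gives the transform on L^2 ([parseval_dil]). *)

(** * Square-integrable functions *)

Section L2.
Context d (T : measurableType d) (R : realType).
Variable mu : {measure set T -> \bar R}.
Implicit Types (f g h : T -> R).

Definition L1 f : Prop := mu.-integrable setT (EFin \o f).

Definition L2 f : Prop := measurable_fun setT f /\ L1 (fun x => f x ^+ 2).

Definition ip f g : R := \int[mu]_x (f x * g x).

(** The squared norm: it is polynomial in the function, unlike the norm. *)
Definition nsq f : R := ip f f.

Lemma L1_measurable f : L1 f -> measurable_fun setT f.
Proof. by move=> /measurable_int /measurable_EFinP. Qed.

Lemma L1_le f g : measurable_fun setT f -> (forall x, `|f x| <= g x) ->
  L1 g -> L1 f.
Proof.
move=> mf fg ig; apply: le_integrable ig => //; first exact/measurable_EFinP.
by move=> x _; rewrite /= lee_fin (le_trans (fg x)) ?ler_norm.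
Qed.

Lemma L1D f g : L1 f -> L1 g -> L1 (fun x => f x + g x).
Proof. by move=> If Ig; apply: (integrableD measurableT If Ig). Qed.

Lemma L1B f g : L1 f -> L1 g -> L1 (fun x => f x - g x).
Proof. by move=> If Ig; apply: (integrableB measurableT If Ig). Qed.

Lemma L1Z a f : L1 f -> L1 (fun x => a * f x).
Proof. by move=> If; apply: (integrableZl measurableT a If). Qed.

Lemma L1_norm f : L1 f -> L1 (fun x => `|f x|).
Proof. by move=> If; apply: (integrable_norm If). Qed.

Lemma intD f g : L1 f -> L1 g ->
  \int[mu]_x (f x + g x) = \int[mu]_x f x + \int[mu]_x g x.
Proof. exact: RintegralD. Qed.

Lemma intB f g : L1 f -> L1 g ->
  \int[mu]_x (f x - g x) = \int[mu]_x f x - \int[mu]_x g x.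
Proof. exact: RintegralB. Qed.

Lemma intZ a f : L1 f -> \int[mu]_x (a * f x) = a * \int[mu]_x f x.
Proof. by move=> If; rewrite RintegralZl. Qed.

Lemma le_int f g : L1 f -> L1 g -> (forall x, f x <= g x) ->
  \int[mu]_x f x <= \int[mu]_x g x.
Proof. by move=> If Ig fg; apply: le_Rintegral. Qed.

Lemma le_norm_int f : L1 f -> `|\int[mu]_x f x| <= \int[mu]_x `|f x|.
Proof. exact: le_normr_Rintegral. Qed.

Lemma int_fineK f : L1 f -> (\int[mu]_x (f x)%:E = (\int[mu]_x f x)%:E)%E.
Proof. by move=> If; rewrite fineK//; apply: integrable_fin_num. Qed.

Lemma L2M f g : L2 f -> L2 g -> L1 (fun x => f x * g x).
Proof.
move=> [mf If] [mg Ig]; apply: (L1_le _ _ (L1D If Ig)).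
  exact: measurable_funM.
move=> x; rewrite normrM -[f x ^+ 2]real_normK ?num_real//.
rewrite -[g x ^+ 2]real_normK ?num_real//.
by have := normr_ge0 (f x); have := normr_ge0 (g x); nra.
Qed.

Lemma L2Z a f : L2 f -> L2 (fun x => a * f x).
Proof.
move=> [mf If]; split; first exact: measurable_funM.
by under eq_fun do rewrite exprMn; apply: L1Z.
Qed.

Lemma L2D f g : L2 f -> L2 g -> L2 (fun x => f x + g x).
Proof.
move=> Lf Lg; have [mf If] := Lf; have [mg Ig] := Lg; split.
  exact: measurable_funD.
under eq_fun do rewrite sqrrD -mulr_natl.
by apply: L1D => //; apply: L1D => //; apply/L1Z/L2M.
Qed.

Lemma L2B f g : L2 f -> L2 g -> L2 (fun x => f x - g x).
Proof.
by move=> Lf Lg; under eq_fun do rewrite -mulN1r; apply/L2D/L2Z.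
Qed.

Lemma L2_0 : L2 (fun=> 0).
Proof.
split=> //; under eq_fun do rewrite expr0n/=.
exact: integrable0.
Qed.

Lemma L2_le f g : measurable_fun setT f -> (forall x, `|f x| <= `|g x|) ->
  L2 g -> L2 f.
Proof.
move=> mf fg [mg Ig]; split=> //; apply: (L1_le _ _ Ig).
  exact: measurable_funX.
by move=> x; rewrite normrX -[leRHS]real_normK ?num_real// lerXn2r ?nnegrE.
Qed.

Lemma ipC f g : ip f g = ip g f.
Proof. by apply: eq_Rintegral => x _; rewrite mulrC. Qed.

Lemma ipDl f g h : L2 f -> L2 g -> L2 h ->
  ip (fun x => f x + g x) h = ip f h + ip g h.
Proof.
move=> Lf Lg Lh; rewrite /ip -intD; try exact: L2M.
by apply: eq_Rintegral => x _; rewrite mulrDl.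
Qed.

Lemma ipBl f g h : L2 f -> L2 g -> L2 h ->
  ip (fun x => f x - g x) h = ip f h - ip g h.
Proof.
move=> Lf Lg Lh; rewrite /ip -intB; try exact: L2M.
by apply: eq_Rintegral => x _; rewrite mulrBl.
Qed.

Lemma ipZl a f g : L2 f -> L2 g -> ip (fun x => a * f x) g = a * ip f g.
Proof.
move=> Lf Lg; rewrite /ip -intZ; last exact: L2M.
by apply: eq_Rintegral => x _; rewrite mulrA.
Qed.

Lemma ipBr f g h : L2 f -> L2 g -> L2 h ->
  ip h (fun x => f x - g x) = ip h f - ip h g.
Proof. by move=> Lf Lg Lh; rewrite !(ipC h) ipBl. Qed.

Lemma ipDr f g h : L2 f -> L2 g -> L2 h ->
  ip h (fun x => f x + g x) = ip h f + ip h g.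
Proof. by move=> Lf Lg Lh; rewrite !(ipC h) ipDl. Qed.

Lemma nsqE f : nsq f = \int[mu]_x (f x ^+ 2).
Proof. by apply: eq_Rintegral => x _; rewrite expr2. Qed.

Lemma nsq_ge0 f : 0 <= nsq f.
Proof. by apply: Rintegral_ge0 => x _; rewrite -expr2 sqr_ge0. Qed.

Lemma nsqD f g : L2 f -> L2 g ->
  nsq (fun x => f x + g x) = nsq f + 2 * ip f g + nsq g.
Proof.
move=> Lf Lg; rewrite /nsq ipDl//; last exact: L2D.
by rewrite !(ipC _ (fun x => _ + _)) !ipDl// (ipC g f); ring.
Qed.

Lemma nsqZ a f : L2 f -> nsq (fun x => a * f x) = a ^+ 2 * nsq f.
Proof.
move=> Lf; rewrite /nsq ipZl//; last exact: L2Z.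
by rewrite ipC ipZl// mulrA.
Qed.

Lemma nsqB f g : L2 f -> L2 g ->
  nsq (fun x => f x - g x) = nsq f - 2 * ip f g + nsq g.
Proof.
move=> Lf Lg; have -> : (fun x => f x - g x) = (fun x => f x + -1 * g x).
  by apply/funext => x; rewrite mulN1r.
rewrite nsqD ?nsqZ//; last exact: L2Z.
by rewrite (ipC f) ipZl// (ipC g); ring.
Qed.

Lemma nsqD_le f g : L2 f -> L2 g ->
  nsq (fun x => f x + g x) <= 2 * nsq f + 2 * nsq g.
Proof.
move=> Lf Lg; have := nsq_ge0 (fun x => f x - g x).
by rewrite nsqB// nsqD//; lra.
Qed.

Lemma nsqB_le f g : L2 f -> L2 g ->
  nsq (fun x => f x - g x) <= 2 * nsq f + 2 * nsq g.
Proof.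
move=> Lf Lg; have := nsq_ge0 (fun x => f x + g x).
by rewrite nsqB// nsqD//; lra.
Qed.

Lemma nsqBC f g : nsq (fun x => f x - g x) = nsq (fun x => g x - f x).
Proof. by apply: eq_Rintegral => x _; ring. Qed.

Lemma cauchy_schwarz f g : L2 f -> L2 g -> ip f g ^+ 2 <= nsq f * nsq g.
Proof.
move=> Lf Lg.
have H t : 0 <= nsq f + 2 * t * ip f g + t ^+ 2 * nsq g.
  have := nsq_ge0 (fun x => f x + t * g x).
  rewrite nsqD// ?nsqZ//; last exact: L2Z.
  by rewrite (ipC f) ipZl// (ipC g); lra.
have [g0|g0] := eqVneq (nsq g) 0.
  (* The quadratic form is affine in t, so its slope vanishes. *)
  rewrite g0 mulr0; have [->|i0] := eqVneq (ip f g) 0; first by rewrite expr0n.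
  have := H (- (nsq f + 1) / (2 * ip f g)).
  rewrite g0 (_ : nsq f + _ + _ = -1); first by lra.
  by field.
have gp : 0 < nsq g by rewrite lt_def g0 nsq_ge0.
have := H (- ip f g / nsq g).
rewrite (_ : _ + _ = nsq f - ip f g ^+ 2 / nsq g); last by field.
by rewrite subr_ge0 ler_pdivrMr.
Qed.

Lemma ip_norm_le f g : L2 f -> L2 g ->
  `|ip f g| <= Num.sqrt (nsq f) * Num.sqrt (nsq g).
Proof.
move=> Lf Lg; rewrite -sqrtrM ?nsq_ge0// -sqrtr_sqr ler_wsqrtr//.
exact: cauchy_schwarz.
Qed.

Definition cvgL2sq (f_ : nat -> T -> R) f : Prop :=
  nsq (fun x => f_ n x - f x) @[n --> \oo] --> (0 : R).

Lemma ip_cvg (f_ g_ : nat -> T -> R) f g :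
  (forall n, L2 (f_ n)) -> (forall n, L2 (g_ n)) -> L2 f -> L2 g ->
  cvgL2sq f_ f -> cvgL2sq g_ g ->
  ip (f_ n) (g_ n) @[n --> \oo] --> ip f g.
Proof.
move=> Lf_ Lg_ Lf Lg cf cg.
pose df n x := f_ n x - f x; pose dg n x := g_ n x - g x.
have Ldf n : L2 (df n) by apply: L2B.
have Ldg n : L2 (dg n) by apply: L2B.
have E n : ip (f_ n) (g_ n) = ip f g + ip f (dg n) + ip g (df n)
    + ip (df n) (dg n).
  rewrite /df /dg !ipBr ?ipBl// ?(ipC g) //; last exact: L2B.
  by rewrite (ipC (f_ n) g) (ipC f g); rewrite (ipC g (f_ n)) (ipC g f); ring.
have sq (h : nat -> T -> R) : (nsq (h n) @[n --> \oo] --> (0 : R)) ->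
    Num.sqrt (nsq (h n)) @[n --> \oo] --> (0 : R).
  move=> H; rewrite -[X in _ --> X](@sqrtr0 R).
  by apply: (cvg_comp _ _ H); exact: sqrt_continuous.
have z h (k : nat -> T -> R) : L2 h -> (forall n, L2 (k n)) ->
    (nsq (k n) @[n --> \oo] --> (0 : R)) -> ip h (k n) @[n --> \oo] --> (0 : R).
  move=> Lh Lk H; apply/norm_cvg0P.
  apply: (@squeeze_cvgr _ _ _ _ (cst 0) (fun n => Num.sqrt (nsq h) *
    Num.sqrt (nsq (k n)))).
  - by apply: nearW => n /=; rewrite normr_ge0 ip_norm_le.
  - exact: cvg_cst.
  - by rewrite -[X in _ --> X](mulr0 (Num.sqrt (nsq h))); apply: cvgM (sq _ H); exact: cvg_cst.
have -> : (fun n => ip (f_ n) (g_ n)) = (fun n => ip f g + ip f (dg n)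
    + ip g (df n) + ip (df n) (dg n)) by apply/funext.
rewrite [X in _ --> X](_ : _ = ip f g + 0 + 0 + 0); last by rewrite !addr0.
apply: cvgD; first apply: cvgD; first apply: cvgD.
- exact: cvg_cst.
- exact: z.
- exact: z.
- apply/norm_cvg0P.
  apply: (@squeeze_cvgr _ _ _ _ (cst 0) (fun n => Num.sqrt (nsq (df n)) *
    Num.sqrt (nsq (dg n)))).
  - by apply: nearW => n /=; rewrite normr_ge0 ip_norm_le.
  - exact: cvg_cst.
  - by rewrite -[X in _ --> X](mulr0 (0:R)); apply: cvgM; apply: sq.
Qed.

(** Fatou's lemma for real-valued functions; the integrability of the limit is
    the part used to see that a transform is square-integrable. *)
Lemma fatou_le (h_ : nat -> T -> R) h (c : R) :
  (forall n, L1 (h_ n)) -> (forall n x, 0 <= h_ n x) ->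
  (forall x, h_ n x @[n --> \oo] --> h x) ->
  (forall n, \int[mu]_x h_ n x <= c) ->
  L1 h /\ \int[mu]_x h x <= c.
Proof.
move=> Ih h0 hc hle.
have mh_ n : measurable_fun setT (h_ n) by exact/L1_measurable.
have mh : measurable_fun setT h.
  by apply: (measurable_fun_cvg mh_) => x _; exact: hc.
have h00 x : 0 <= h x.
  by apply: (cvgr_to_ge (hc x)); exact: nearW.
have le_c : (\int[mu]_x (h x)%:E <= c%:E)%E.
  apply: (@le_trans _ _ (limn_einf (fun n => \int[mu]_x (h_ n x)%:E)%E)).
    rewrite (eq_integral (fun x => limn_einf (fun n => (h_ n x)%:E))).
      apply: fatou => //.
        by move=> n; exact/measurable_EFinP.
      by move=> n x _; rewrite lee_fin.
    move=> x _; have /cvg_limn_einf_sup[-> _] // : (h_ n x)%:E @[n --> \oo] --> (h x)%:E.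
    by apply: cvg_EFin; [exact: nearW|exact: hc].
  rewrite (_ : (fun n => _) = (fun n => (\int[mu]_x h_ n x)%:E)).
    rewrite limn_einf_lim; apply: lime_le; first exact: is_cvg_einfs.
    apply: nearW => n; apply: ge_ereal_inf.
    by exists (\int[mu]_x h_ n x)%:E; [exists n => /=|rewrite lee_fin].
  by apply/funext => n; rewrite int_fineK.
have Ih' : L1 h.
  apply/integrableP; split; first exact/measurable_EFinP.
  apply: le_lt_trans (ltry c); apply: le_trans le_c.
  by under eq_integral do rewrite /= ger0_norm//.
by split => //; rewrite -lee_fin -int_fineK.
Qed.

Lemma dct (f_ : nat -> T -> R) f g :
  (forall n, measurable_fun setT (f_ n)) ->
  (forall x, f_ n x @[n --> \oo] --> f x) ->
  L1 g -> (forall n x, `|f_ n x| <= g x) ->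
  L1 f /\ \int[mu]_x f_ n x @[n --> \oo] --> \int[mu]_x f x.
Proof.
move=> mf_ fc Ig fg.
have mf : measurable_fun setT f by apply: (measurable_fun_cvg mf_) => x _; exact: fc.
have [] := @dominated_convergence _ _ _ mu setT measurableT
  (fun n => EFin \o f_ n) (EFin \o f) (EFin \o g).
- by move=> n; exact/measurable_EFinP.
- exact/measurable_EFinP.
- by apply: aeW => x _; apply: cvg_EFin; [exact: nearW|exact: fc].
- exact: Ig.
- by apply: aeW => x n _; rewrite /= lee_fin.
move=> If _ H; split=> //.
by apply: fine_cvg; rewrite -int_fineK in H *.
Qed.

(** Bounded sequences that converge pointwise converge weakly. With the
    remainder [r = q_ n - q] one has
    [|g| |r| <= |g| min(|r|, K |g|) + r^2 / K] pointwise: if [|r| > K |g|] the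
    second term dominates. For fixed [K] the first term is at most [K g^2] and
    tends to 0 by dominated convergence, and the second has an integral of
    order [1 / K], uniformly in [n]. *)
Lemma weak_cvg g (q_ : nat -> T -> R) q (C : R) :
  L2 g -> (forall n, L2 (q_ n)) -> L2 q ->
  (forall n, nsq (q_ n) <= C) ->
  (forall x, q_ n x @[n --> \oo] --> q x) ->
  ip g (q_ n) @[n --> \oo] --> ip g q.
Proof.
move=> Lg Lq_ Lq qC qc.
pose r n x := q_ n x - q x.
have Lr n : L2 (r n) by apply: L2B.
pose C' := 2 * C + 2 * nsq q.
have rC n : nsq (r n) <= C'.
  rewrite /r; have := nsq_ge0 (fun x => q_ n x + q x).
  by rewrite nsqD// nsqB//; have := qC n; rewrite /C'; lra.
have [[mg Ig] mr] : L2 g /\ forall n, measurable_fun setT (r n).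
  by split=> // n; case: (Lr n).
pose m K n x := `|g x| * Num.min `|r n x| (K * `|g x|).
have mm K n : measurable_fun setT (m K n).
  apply: measurable_funM; first exact: measurableT_comp.
  apply: measurable_minr; first exact: measurableT_comp.
  by apply: measurable_funM => //; exact: measurableT_comp.
have mle K n x : 0 <= K -> `|m K n x| <= K * g x ^+ 2.
  move=> K0; rewrite ger0_norm; last by rewrite mulr_ge0// le_min normr_ge0 mulr_ge0.
  rewrite -real_normK ?num_real// expr2 mulrCA ler_wpM2l//.
  by rewrite ge_min lexx orbT.
have Im K n : 0 <= K -> L1 (m K n).
  by move=> K0; apply: (L1_le _ _ (L1Z K Ig)) => // x; exact: mle.
have bnd K n : 0 < K -> `|ip g (r n)| <= \int[mu]_x m K n x + C' / K.
  move=> K0; apply: (le_trans (le_norm_int (L2M Lg (Lr n)))).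
  apply: (@le_trans _ _ (\int[mu]_x (m K n x + K^-1 * r n x ^+ 2))).
    apply: le_int.
    - exact/L1_norm/L2M.
    - by apply: L1D; [exact/Im/ltW|apply/L1Z; case: (Lr n)].
    - move=> x; rewrite normrM /m; case: (leP `|r n x| (K * `|g x|)) => [h|/ltW h].
        by rewrite lerDl mulr_ge0 ?invr_ge0 ?(ltW K0)// sqr_ge0.
      rewrite -[leLHS]add0r lerD//.
        by rewrite !mulr_ge0 // ltW.
      rewrite ler_pdivlMl// -(real_normK (num_real (r n x))) expr2 mulrA ler_wpM2r//.
  rewrite intD ?intZ; [|by case: (Lr n)|exact/Im/ltW|apply/L1Z; by case: (Lr n)].
  by rewrite lerD2l mulrC ler_pM2r ?invr_gt0// -nsqE.
have dct K : 0 < K -> \int[mu]_x m K n x @[n --> \oo] --> (0 : R).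
  move=> K0.
  have [//||||_] := @dct (m K) (cst 0) (fun x => K * g x ^+ 2).
  - move=> x; have rx : `|r n x| @[n --> \oo] --> (0 : R).
      by apply/norm_cvg0P/subr_cvg0; exact: qc.
    apply: (@squeeze_cvgr _ _ _ _ (cst 0) (fun n => `|g x| * `|r n x|)).
    + apply: nearW => n /=; rewrite /m mulr_ge0 ?ler_wpM2l ?ge_min ?lexx//.
      by rewrite le_min normr_ge0 mulr_ge0// ltW.
    + exact: cvg_cst.
    + by rewrite -[X in _ --> X](mulr0 `|g x|); apply: cvgM rx; exact: cvg_cst.
  - exact: L1Z.
  - by move=> n x; exact/mle/ltW.
  - by rewrite /Rintegral integral0.
suff H : ip g (r n) @[n --> \oo] --> (0 : R).
  have E n : ip g (q_ n) = ip g q + ip g (r n).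
    by rewrite /r ipBr//; ring.
  have -> : (fun n => ip g (q_ n)) = (fun n => ip g q + ip g (r n)).
    exact/funext.
  by rewrite -[X in _ --> X]addr0; apply: cvgD => //; exact: cvg_cst.
apply/cvgrPdist_le => e e0.
have C0 : 0 <= C' by apply: le_trans (rC 0%N); exact: nsq_ge0.
(* With this [K] the remainder [C' / K] is less than [e / 2]. *)
have K0 : 0 < 2 * (C' + 1) / e by rewrite divr_gt0// mulr_gt0//; lra.
have /cvgrPdist_le/(_ (e / 2)) := dct _ K0.
rewrite divr_gt0// => /(_ isT); apply: filterS => n.
rewrite !sub0r !normrN => hn.
apply: (le_trans (bnd _ n K0)); rewrite [leRHS](splitr e) lerD//.
  by apply: le_trans hn; exact: ler_norm.
rewrite invf_div mulrA ler_pdivrMr ?mulr_gt0//; lra.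
Qed.

End L2.

(** * Dilations *)

(** A map that multiplies the integrals of nonnegative functions by a constant
    multiplies all integrals and inner products by it. *)
Section change_of_variable.
Context d (T : measurableType d) (R : realType).
Variables (mu : {measure set T -> \bar R}) (t : T -> T) (k : R).
Hypotheses (mt : measurable_fun setT t) (k0 : 0 <= k).
Hypothesis tE : forall f : T -> \bar R, measurable_fun setT f ->
  (forall x, 0 <= f x)%E -> (\int[mu]_x f (t x) = k%:E * \int[mu]_x f x)%E.

Lemma L1_comp (f : T -> R) : L1 mu f -> L1 mu (f \o t).
Proof.
move=> If; have mf := L1_measurable If.
apply/integrableP; split; first exact/measurable_EFinP/measurableT_comp.
rewrite (tE (f := fun x => `|(f x)%:E|%E))//.
  by rewrite lte_mul_pinfty ?lee_fin//; case/integrableP: If.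
exact/measurableT_comp/measurable_EFinP.
Qed.

Lemma int_comp (f : T -> R) : L1 mu f ->
  \int[mu]_x f (t x) = k * \int[mu]_x f x.
Proof.
move=> If; have Ift := L1_comp If; have mf := L1_measurable If.
apply: EFin_inj; rewrite EFinM -!int_fineK//.
rewrite integralE [in RHS]integralE muleBr//; last first.
  by apply: fin_num_adde_defr; exact: (integrable_pos_fin_num measurableT If).
congr (_ - _)%E; rewrite -tE//.
- by apply: eq_integral => x _; rewrite !funeposE.
- exact/measurable_funepos/measurable_EFinP.
- by apply: eq_integral => x _; rewrite !funenegE.
- exact/measurable_funeneg/measurable_EFinP.
Qed.

Lemma L2_comp (f : T -> R) : L2 mu f -> L2 mu (f \o t).
Proof. by move=> [mf If]; split; [exact: measurableT_comp|exact: (L1_comp If)]. Qed.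

Lemma ip_comp (f g : T -> R) : L2 mu f -> L2 mu g ->
  ip mu (f \o t) (g \o t) = k * ip mu f g.
Proof. by move=> Lf Lg; rewrite /ip -int_comp//; exact: L2M. Qed.

End change_of_variable.

Section dilation.
Context (R : realType).
Notation leb := (@lebesgue_measure R).
Implicit Types c : R.

Lemma ge0_int_dilation1 c (f : measurableTypeR R -> \bar R) : c != 0 ->
  measurable_fun setT f -> (forall x, 0 <= f x)%E ->
  (\int[leb]_x f (c * x)%R = `|c|^-1%:E * \int[leb]_x f x)%E.
Proof.
move=> c0 mf f0.
have mc : measurable_fun setT ( *%R c : measurableTypeR R -> measurableTypeR R).
  exact: measurable_funM.
(* Lebesgue measure is [|c|] times its image under the multiplication by [c],
   since both measure half-open intervals by their length. *)
pose pf : {measure set (measurableTypeR R) -> \bar R} :=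
  measure_function_pushforward__canonical__measure_function_Measure leb mc.
pose nu := mscale (NngNum (normr_ge0 c)) pf.
have nuE A : measurable A -> leb A = nu A.
  apply: lebesgue_measure_unique => _ [[a b] _ <-] /=.
  rewrite /nu /mscale/= /pushforward.
  have [c_gt0|c_lt0|/eqP] := ltgtP 0 c; last by rewrite eq_sym (negbTE c0).
  - have -> : *%R c @^-1` `]a, b]%classic = `]a / c, b / c]%classic.
      apply/seteqP; split=> x /=; rewrite !in_itv/=;
        by rewrite ltr_pdivrMr// ler_pdivlMr// mulrC.
    rewrite lebesgue_measure_itv lebesgue_measure_itv/= !lte_fin.
    rewrite ltr_pM2r ?invr_gt0//; case: ifP => _; last by rewrite mule0.
    by rewrite -EFinM gtr0_norm// -EFinD; congr EFin; field.
  - have -> : *%R c @^-1` `]a, b]%classic = `[b / c, a / c[%classic.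
      apply/seteqP; split=> x /=; rewrite !in_itv/=;
        by rewrite ltr_ndivlMr// ler_ndivrMr// mulrC andbC.
    rewrite lebesgue_measure_itv lebesgue_measure_itv/= !lte_fin.
    rewrite ltr_nM2r ?invr_lt0//; case: ifP => _; last by rewrite mule0.
    by rewrite -EFinM ltr0_norm// -EFinD; congr EFin; field.
rewrite [in RHS](eq_measure_integral nu) => [|A mA _]; last exact: nuE.
rewrite ge0_integral_mscale// muleA -EFinM/= mulVf ?normr_eq0// mul1e.
by rewrite ge0_integral_pushforward.
Qed.

Lemma ge0_int_dilation2 c (f : plane R -> \bar R) : c != 0 ->
  measurable_fun setT f -> (forall x, 0 <= f x)%E ->
  (\int[leb2 R]_x f (c * x.1, c * x.2)%R
     = (`|c|^-1 ^+ 2)%:E * \int[leb2 R]_x f x)%E.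
Proof.
move=> c0 mf f0.
have mc : measurable_fun setT (fun x : plane R => (c * x.1, c * x.2) : plane R).
  by apply: measurable_fun_pair; apply: measurable_funM.
rewrite fubini_tonelli1//; last by exact: measurableT_comp.
rewrite fubini_tonelli1// /fubini_F.
transitivity (\int[leb]_x (`|c|^-1%:E * \int[leb]_y f ((c * x)%R, y)))%E.
  apply: eq_integral => x _; rewrite /=.
  rewrite (@ge0_int_dilation1 c (fun y => f (c * x, y)))//.
  exact: measurableT_comp.
have mF := measurable_fun_fubini_tonelli_F (m2 := leb) f mf f0.
have F0 x : (0 <= fubini_F leb f x)%E by apply: integral_ge0.
rewrite ge0_integralZl//.
- rewrite (@ge0_int_dilation1 c (fubini_F leb f))//.
  by rewrite muleA -EFinM.
- exact: (measurableT_comp mF).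
- by move=> x _; exact: F0.
Qed.

End dilation.

(** * The Fourier transform of an interval *)

Section interval_transform.
Context (R : realType).
Notation leb := (@lebesgue_measure R).
Implicit Types (a b c d t x : R) (f g : measurableTypeR R -> R).

(** The inverse, with [0^-1 = 0], is the pointwise limit of the continuous
    functions [x / (x^2 + 1/n)]. *)
Lemma measurable_invr : measurable_fun setT (GRing.inv : R -> R).
Proof.
pose h (n : nat) (x : R) := x * (x ^+ 2 + n.+1%:R^-1)^-1.
have pos n x : 0 < x ^+ 2 + n.+1%:R^-1.
  by rewrite ltr_wpDl ?sqr_ge0// invr_gt0.
apply: (@measurable_fun_cvg _ _ _ _ h).
  move=> n; apply: continuous_measurable_fun => x.
  apply: cvgM; first exact: cvg_id.
  apply: cvgV; first by rewrite gt_eqF.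
  by apply: cvgD; [exact: exprn_continuous|exact: cvg_cst].
move=> x _; rewrite /h; have [->|x0] := eqVneq x 0.
  rewrite invr0; under eq_fun do rewrite mul0r; exact: cvg_cst.
rewrite [X in _ --> X](_ : _ = x * (x ^+ 2 + 0)^-1); last by rewrite addr0; field.
apply: cvgM; first exact: cvg_cst.
apply: cvgV; first by rewrite addr0 expf_neq0.
by apply: cvgD; [exact: cvg_cst|exact: cvg_harmonic].
Qed.

Lemma sin_norm_le x : `|sin x| <= `|x|.
Proof.
have H (y : R) : 0 < y -> `|sin y| <= y.
  move=> y0; have [|z _] := @MVT R sin cos 0 y y0 (fun z _ => is_derive_sin z).
    by apply: continuous_subspaceT; exact: continuous_sin.
  rewrite sin0 !subr0 => ->; rewrite normrM (gtr0_norm y0).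
  by rewrite ler_piMl ?cos_max// ltW.
have [x0|x0|<-] := ltgtP 0 x; last by rewrite sin0.
  by rewrite (gtr0_norm x0) H.
by rewrite -normrN -sinN (ltr0_norm x0) H// oppr_gt0.
Qed.

Lemma onem_cos_le x : 1 - cos x <= x ^+ 2 / 2.
Proof.
have -> : x = (x / 2) *+ 2 by rewrite mulr2n -splitr.
rewrite cos_mulr2n cos2sin2.
have : sin (x / 2) ^+ 2 <= (x / 2) ^+ 2.
  by rewrite -(real_normK (num_real (sin _))) -(real_normK (num_real (x / 2)))
    lerXn2r ?nnegrE// sin_norm_le.
by move: (sin _) => y; lra.
Qed.

(** Up to a factor 2 this is the squared modulus of the transform of an interval
    of length [t]. *)
Definition kcos t x := (1 - cos (t * x)) / x ^+ 2.

Lemma measurable_kcos t : measurable_fun setT (kcos t : measurableTypeR R -> R).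
Proof.
apply: measurable_funM.
  apply: measurable_funB => //.
  apply: (measurableT_comp (f := cos)); last exact: measurable_funM.
  by apply: continuous_measurable_fun; exact: continuous_cos.
by apply: measurableT_comp measurable_invr _; exact: measurable_funX.
Qed.

Lemma kcos_ge0 t x : 0 <= kcos t x.
Proof. by rewrite divr_ge0 ?sqr_ge0// subr_ge0 cos_le1. Qed.

Lemma L1_oneDsqrV : L1 leb (fun x => (1 + x ^+ 2)^-1).
Proof.
have := @ge0_symfun_integralT R (fun x => (oneDsqr x)^-1).
rewrite (_ : [set x : R | 0 <= x] = `[0, +oo[%classic); last first.
  by apply/seteqP; split=> x /=; rewrite in_itv/= andbT.
rewrite integral0y_oneDsqr => H.
apply/integrableP; split.
  have m := continuous_measurable_fun (@continuous_oneDsqrV R).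
  by apply/measurable_EFinP; exact: m.
under eq_integral => x _ do rewrite /= ger0_norm ?invr_ge0 ?addr_ge0 ?sqr_ge0//.
rewrite H ?ltry//.
- exact: continuous_oneDsqrV.
- by move=> x /=; rewrite /oneDsqr sqrrN.
Qed.

Lemma L1_kcos1 : L1 leb (kcos 1).
Proof.
apply: (L1_le _ _ (L1Z 3 L1_oneDsqrV)); first exact: measurable_kcos.
(* The constant 3 comes from
   [(1 - cos x) (1 + x^2) <= x^2 / 2 + 2 x^2]. *)
move=> x; rewrite ger0_norm ?kcos_ge0// /kcos mul1r.
have [->|x0] := eqVneq x 0.
  by rewrite cos0 subrr mul0r expr0n /= addr0 invr1.
have x2 : 0 < x ^+ 2 by rewrite exprn_even_gt0.
rewrite ler_pdivrMr// mulrAC ler_pdivlMr; last by lra.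
have := onem_cos_le x; have := cos_geN1 x; have := cos_le1 x.
by move: (cos x) => z; nra.
Qed.

(** This integral is pi; it enters only as a positive constant, because Parseval's
    identity is used up to a positive factor. *)
Definition Ccos : R := \int[leb]_x kcos 1 x.

(** On [1, 2] the cosine is at most [cos 1 < 1], as it decreases there. *)
Lemma Ccos_gt0 : 0 < Ccos.
Proof.
pose m := (1 - cos 1) / 4 : R.
have cos1 : cos 1 < 1 :> R.
  by rewrite -[ltRHS]cos0 ltr_cos ?ltr01// in_itv/= ?lexx ?ler01 ?pi_ge0//; have := pi_ge2 R; lra.
have m0 : 0 < m by rewrite divr_gt0// subr_gt0.
apply: (@lt_le_trans _ _ (\int[leb]_x (m * \1_(`[1, 2]%classic) x))).
  rewrite intZ; last exact: integrable_indic_itv.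
  rewrite mulr_gt0// /Rintegral integral_indic//= setIT lebesgue_measure_itv/=.
  by rewrite lte_fin ltr1n /=; lra.
apply: le_int; [exact/L1Z/integrable_indic_itv|exact: L1_kcos1|move=> x].
rewrite indicE; have [/set_mem/=|_] := boolP (x \in _); last by rewrite mulr0 kcos_ge0.
rewrite in_itv/= mulr1 /kcos mul1r => /andP[x1 x2].
rewrite ler_pM// ?subr_ge0 ?cos_le1 ?invr_ge0 ?sqr_ge0//.
  rewrite lerD2l lerN2; have [->//|x1'] := eqVneq x 1.
  have x1lt : 1 < x by rewrite lt_neqAle eq_sym x1' x1.
  have pi2 := pi_ge2 R; apply/ltW; rewrite ltr_cos//; rewrite in_itv/=; lra.
by rewrite lef_pV2 ?posrE ?exprn_gt0//; nra.
Qed.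

Lemma kcosE t x : t != 0 -> kcos t x = t ^+ 2 * kcos 1 (t * x).
Proof.
move=> t0; rewrite /kcos mul1r; have [->|x0] := eqVneq x 0.
  by rewrite mulr0 cos0 subrr !mul0r mulr0.
by field; rewrite x0 t0.
Qed.

(** The homogeneity [kcos t x = t^2 kcos 1 (t x)] determines the dependence on
    [t] without the value of the integral being computed. *)
Lemma int_kcos t : L1 leb (kcos t) /\ \int[leb]_x kcos t x = Ccos * `|t|.
Proof.
have [->|t0] := eqVneq t 0.
  have -> : kcos 0 = fun=> 0.
    by apply/funext => x; rewrite /kcos mul0r cos0 subrr mul0r.
  by rewrite normr0 mulr0 /Rintegral integral0; split => //; exact: integrable0.
have mt : measurable_fun setT ( *%R t : measurableTypeR R -> measurableTypeR R).
  exact: measurable_funM.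
have tE := fun h => @ge0_int_dilation1 R t h t0.
have t'0 : 0 <= `|t|^-1 by rewrite invr_ge0.
have L := L1_comp mt t'0 tE L1_kcos1.
have -> : kcos t = fun x => t ^+ 2 * (kcos 1 \o *%R t) x.
  by apply/funext => x; rewrite kcosE.
split; first exact: L1Z.
rewrite intZ// (int_comp mt t'0 tE L1_kcos1) -/Ccos -real_normK ?num_real//.
by field; rewrite normr_eq0.
Qed.

Lemma int_odd f : L1 leb f -> (forall x, f (- x) = - f x) ->
  \int[leb]_x f x = 0.
Proof.
move=> If fodd.
have mN : measurable_fun setT ( *%R (-1) : measurableTypeR R -> measurableTypeR R).
  exact: measurable_funM.
have := int_comp mN (k := `|-1|^-1) _ _ If.
rewrite normrN1 invr1 mul1r => /(_ ler01).
move=> H; have {H} : \int[leb]_x f (-1 * x) = \int[leb]_x f x.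
  apply: H => h mh h0; rewrite ge0_int_dilation1// ?oppr_eq0//.
  by rewrite normrN1 invr1.
have -> : \int[leb]_x f (-1 * x) = \int[leb]_x (-1 * f x).
  by apply: eq_Rintegral => x _; rewrite !mulN1r fodd.
by rewrite intZ//; lra.
Qed.

End interval_transform.

Section indicator.
Context d (T : measurableType d) (R : realType).
Variable mu : {measure set T -> \bar R}.

Lemma patch_mul_indic (A : set T) (f : T -> R) : f \_ A = fun x => f x * \1_A x.
Proof.
apply/funext => x; rewrite patchE indicE.
by case: ifP => _; rewrite ?mulr1 ?mulr0.
Qed.

Lemma L1_indicP (A : set T) (f : T -> R) : measurable A ->
  mu.-integrable A (EFin \o f) <-> L1 mu (fun x => f x * \1_A x).
Proof.
move=> mA; rewrite /L1 -patch_mul_indic -restrict_EFin.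
exact: integrable_mkcond.
Qed.

Lemma int_indic (A : set T) (f : T -> R) :
  \int[mu]_(x in A) f x = \int[mu]_x (f x * \1_A x).
Proof. by rewrite Rintegral_mkcond patch_mul_indic. Qed.

End indicator.

Section interval_transform2.
Context (R : realType).
Notation leb := (@lebesgue_measure R).
Implicit Types (a b c d t x : R) (f g : measurableTypeR R -> R).

Lemma L1_itv_continuous (f : R -> R) a b : continuous f ->
  L1 leb (fun t => f t * \1_(`]a, b]%classic) t).
Proof.
move=> cf; apply: (proj1 (@L1_indicP _ _ _ leb _ f _)) => //.
have If : leb.-integrable `[a, b]%classic (EFin \o f).
  apply: continuous_compact_integrable; first exact: segment_compact.
  exact: continuous_subspaceT.
by apply: integrableS If => //; exact: subset_itv_oc_cc.
Qed.

Lemma int_itv_derive (f F : R -> R) a b : a <= b -> continuous f ->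
  (forall x, is_derive x 1 F (f x)) ->
  L1 leb (fun x => f x * \1_(`]a, b]%classic) x) /\
  \int[leb]_x (f x * \1_(`]a, b]%classic) x) = F b - F a.
Proof.
move=> ab cf dF.
have cF : continuous F.
  by move=> x; apply/differentiable_continuous/derivable1_diffP; case: (dF x).
split; first exact: L1_itv_continuous.
rewrite -int_indic Rintegral_itv_obnd_cbnd; last exact/L1_indicP/L1_itv_continuous.
move: ab; rewrite le_eqVlt => /predU1P[<-|ab].
  by rewrite set_itv1 Rintegral_set1 subrr.
rewrite /Rintegral (continuous_FTC2 ab (F := F))//=.
- exact: continuous_subspaceT.
- split; first by move=> x _; case: (dF x).
  + exact/cvg_at_right_filter/cF.
  + exact/cvg_at_left_filter/cF.
- by move=> x _; rewrite derive1E; apply: derive_val.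
Qed.

(** The cosine and sine transforms of the indicator of an interval. Since
    [0^-1 = 0], the quotients vanish at 0; this is the right value for the sine
    transform, while the cosine transform is there the length of the interval. *)
Definition cos_itv a b x : R :=
  (sin (b * x) - sin (a * x)) / x + (b - a) * \1_[set 0] x.

Definition sin_itv a b x : R := (cos (a * x) - cos (b * x)) / x.

Lemma cos_itvE a b t : a <= b ->
  L1 leb (fun x => cos (x * t) * \1_(`]a, b]%classic) x) /\
  \int[leb]_x (cos (x * t) * \1_(`]a, b]%classic) x) = cos_itv a b t.
Proof.
move=> ab; rewrite /cos_itv indicE in_set1; have [->|t0] := eqVneq t 0.
  have -> : (fun x => cos (x * 0) * \1_(`]a, b]%classic) x) =
      (fun x : R => 1 * \1_(`]a, b]%classic) x).
    by apply/funext => x; rewrite mulr0 cos0.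
  rewrite !mulr0 sin0 subrr mul0r add0r mulr1.
  have [] // := @int_itv_derive (cst 1) id a b ab _ _.
  exact: cst_continuous.
rewrite mulr0 addr0 mulrBl.
apply: (@int_itv_derive (fun x => cos (x * t)) (fun x => sin (x * t) / t)) => //.
  move=> x; apply: (@continuous_comp _ _ _ (fun y : R => y * t) (@cos R)); last exact: continuous_cos.
  exact: mulrr_continuous.
move=> x; apply: is_derive_eq.
by rewrite !scaler1 /GRing.scale/=; field.
Qed.

Lemma sin_itvE a b t : a <= b ->
  L1 leb (fun x => sin (x * t) * \1_(`]a, b]%classic) x) /\
  \int[leb]_x (sin (x * t) * \1_(`]a, b]%classic) x) = sin_itv a b t.
Proof.
move=> ab; rewrite /sin_itv; have [->|t0] := eqVneq t 0.
  have -> : (fun x => sin (x * 0) * \1_(`]a, b]%classic) x) = (fun=> 0).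
    by apply/funext => x; rewrite mulr0 sin0 mul0r.
  rewrite invr0 mulr0 /Rintegral integral0; split=> //; exact: integrable0.
rewrite (_ : _ / t = - cos (b * t) / t - (- cos (a * t) / t)); last by field.
apply: (@int_itv_derive (fun x => sin (x * t)) (fun x => - cos (x * t) / t)) => //.
  move=> x; apply: (@continuous_comp _ _ _ (fun y : R => y * t) (@sin R)); last exact: continuous_sin.
  exact: mulrr_continuous.
move=> x; apply: is_derive_eq.
by rewrite !scaler1 /GRing.scale/=; field.
Qed.

Let mtrig (h : R -> R) a : continuous h ->
  measurable_fun setT (fun x : measurableTypeR R => h (a * x)).
Proof.
move=> ch; apply: (measurableT_comp (f := h)); last exact: measurable_funM.
exact: continuous_measurable_fun.
Qed.

Lemma measurable_cos_itv a b : measurable_fun setT (cos_itv a b : measurableTypeR R -> R).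
Proof.
apply: measurable_funD; last exact: measurable_funM.
apply: measurable_funM; last exact: measurable_invr.
by apply: measurable_funB; apply: mtrig; exact: continuous_sin.
Qed.

Lemma measurable_sin_itv a b : measurable_fun setT (sin_itv a b : measurableTypeR R -> R).
Proof.
apply: measurable_funM; last exact: measurable_invr.
by apply: measurable_funB; apply: mtrig; exact: continuous_cos.
Qed.

Lemma L1_indic0 : L1 leb \1_[set 0].
Proof. by rewrite -set_itv1; exact: integrable_indic_itv. Qed.

Lemma cos_sin_itv_sqr a b x : x != 0 ->
  cos_itv a b x ^+ 2 + sin_itv a b x ^+ 2 = 2 * kcos (b - a) x.
Proof.
move=> x0; rewrite /cos_itv /sin_itv /kcos indicE in_set1 (negbTE x0).
rewrite (mulrBl x b a) cosB mulr0 addr0.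
have := cos2Dsin2 (a * x); have := cos2Dsin2 (b * x).
move: (cos (b * x)) (sin (b * x)) (cos (a * x)) (sin (a * x)) => p q r s h1 h2.
have -> : 2 * ((1 - (p * r + q * s)) / x ^+ 2) =
  ((p ^+ 2 + q ^+ 2) + (r ^+ 2 + s ^+ 2) - 2 * (p * r + q * s)) / x ^+ 2.
  by rewrite h1 h2; field.
by field.
Qed.

Lemma L2_cos_itv a b : L2 leb (cos_itv a b).
Proof.
have mc := measurable_cos_itv a b; split=> //.
have [Ik _] := int_kcos (b - a).
apply: (L1_le _ _ (L1D (L1Z 2 Ik) (L1Z ((b - a) ^+ 2) L1_indic0))).
  exact: measurable_funX.
move=> x; rewrite ger0_norm ?sqr_ge0//; have [->|x0] := eqVneq x 0.
  rewrite /cos_itv invr0 mulr0 add0r indicE in_set1 eqxx !mulr1.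
  by rewrite lerDr mulr_ge0// kcos_ge0.
rewrite indicE in_set1 (negbTE x0) mulr0 addr0 -cos_sin_itv_sqr//.
by rewrite lerDl sqr_ge0.
Qed.

Lemma L2_sin_itv a b : L2 leb (sin_itv a b).
Proof.
have mc := measurable_sin_itv a b; split=> //.
have [Ik _] := int_kcos (b - a).
apply: (L1_le _ _ (L1Z 2 Ik)); first exact: measurable_funX.
move=> x; rewrite ger0_norm ?sqr_ge0//; have [->|x0] := eqVneq x 0.
  by rewrite /sin_itv invr0 mulr0 expr0n/= mulr_ge0// kcos_ge0.
by rewrite -cos_sin_itv_sqr// lerDr sqr_ge0.
Qed.

Lemma int_ae_neq0 f g : L1 leb f -> L1 leb g ->
  (forall x, x != 0 -> f x = g x) -> \int[leb]_x f x = \int[leb]_x g x.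
Proof.
move=> If Ig fg; rewrite /Rintegral; congr fine.
apply: ae_eq_integral => //; [exact: measurable_int If|exact: measurable_int Ig|].
exists [set 0]; split => //; first exact: lebesgue_measure_set1.
move=> x /=; apply: contra_notP => /eqP x0 _; by rewrite /= fg.
Qed.

(** The length of the intersection of [[a, b]] and [[c, d]]. *)
Definition len_cap a b c d : R := Num.max 0 (Num.min b d - Num.max a c).

(** The overlap is a second difference of the distance in the end points. This
    is what turns the values [C |t|] of [int_kcos] into inner products. *)
Lemma distB_len_cap a b c d : a <= b -> c <= d ->
  `|b - c| + `|a - d| - (`|b - d| + `|a - c|) = 2 * len_cap a b c d.
Proof.
move=> ab cd; rewrite /len_cap.
have N x y : x <= y -> `|x - y| = y - x by move=> ?; rewrite distrC ger0_norm ?subr_ge0.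
have N' x y : y <= x -> `|x - y| = x - y by move=> ?; rewrite ger0_norm ?subr_ge0.
case: (leP b d) => [bd|/ltW bd]; [rewrite (N b d)//|rewrite (N' b d)//];
(case: (leP a c) => [ac|/ltW ac]; [rewrite (N a c)//|rewrite (N' a c)//]).
- rewrite (N a d); last exact: le_trans bd.
  by case: (leP b c) => [bc|/ltW bc]; [rewrite N// max_l|rewrite N'// max_r]; lra.
- rewrite (N a d) ?(N' b c) ?max_r ?(le_trans _ bd) ?(le_trans ac)//; lra.
- rewrite (N a d) ?(N' b c) ?max_r ?(le_trans _ bd) ?(le_trans ac)//; lra.
- rewrite (N' b c); last exact: le_trans ab.
  by case: (leP a d) => [ad|/ltW ad]; [rewrite N// max_r|rewrite N'// max_l]; lra.
Qed.

(** Parseval's identity for intervals. By the addition theorem the integrand is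
    a combination of four functions [kcos], whose parameters are the differences
    of the end points. *)
Lemma cos_sin_itv_ip a b c d : a <= b -> c <= d ->
  ip leb (cos_itv a b) (cos_itv c d) + ip leb (sin_itv a b) (sin_itv c d)
    = 2 * Ccos R * len_cap a b c d.
Proof.
move=> ab cd.
have [I1 E1] := int_kcos (b - c); have [I2 E2] := int_kcos (a - d).
have [I3 E3] := int_kcos (b - d); have [I4 E4] := int_kcos (a - c).
have Ic := L2M (L2_cos_itv a b) (L2_cos_itv c d).
have Is := L2M (L2_sin_itv a b) (L2_sin_itv c d).
have I12 := L1D I1 I2; have I34 := L1D I3 I4.
rewrite /ip -intD//.
rewrite (int_ae_neq0 (g := fun x => (kcos (b - c) x + kcos (a - d) x)
  - (kcos (b - d) x + kcos (a - c) x))).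
- rewrite intB// !intD// E1 E2 E3 E4 -!mulrDr -mulrBr distB_len_cap//; ring.
- exact: (L1D Ic Is).
- exact: (L1B I12 I34).
- move=> x x0; rewrite /cos_itv /sin_itv /kcos indicE in_set1 (negbTE x0).
  by rewrite !(mulrBl x) !cosB !mulr0 !addr0; field.
Qed.

(** The imaginary part of the inner product of two transforms vanishes by
    parity; it appears when rectangles are treated as products of intervals. *)
Lemma cos_sin_itv_cross a b c d :
  \int[leb]_x (sin_itv a b x * cos_itv c d x - cos_itv a b x * sin_itv c d x) = 0.
Proof.
apply: int_odd.
  by apply: L1B; apply: L2M; (exact: L2_cos_itv || exact: L2_sin_itv).
have s a' b' x : sin_itv a' b' (- x) = - sin_itv a' b' x.
  by rewrite /sin_itv !mulrN !cosN invrN mulrN.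
have c' a' b' x : cos_itv a' b' (- x) = cos_itv a' b' x.
  rewrite /cos_itv !mulrN !sinN invrN mulrN !indicE !in_set1 oppr_eq0.
  by congr (_ + _); rewrite -mulNr opprB opprK addrC.
by move=> x; rewrite !s !c' /=; ring.
Qed.

Lemma indic_itv_ip a b c d : a <= b -> c <= d ->
  ip leb \1_(`]a, b]%classic) \1_(`]c, d]%classic) = len_cap a b c d.
Proof.
move=> ab cd; rewrite /ip.
transitivity (\int[leb]_x \1_(`](Num.max a c), (Num.min b d)]%classic) x).
  apply: eq_Rintegral => x _; rewrite !indicE -natrM mulnb; congr (_%:R).
  rewrite -in_setI; congr (nat_of_bool (_ \in _)); apply/seteqP.
  by split=> y /=; rewrite !in_itv/= gt_max le_min;
    [move=> [/andP[-> ->] /andP[-> ->]]|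
     move=> /andP[/andP[-> ->] /andP[-> ->]]].
rewrite /Rintegral integral_indic//= setIT lebesgue_measure_itv/= lte_fin /len_cap.
case: (ltP (Num.max a c) (Num.min b d)) => h /=; first by rewrite [RHS]max_r// subr_ge0 ltW.
by rewrite [RHS]max_l// subr_le0.
Qed.

End interval_transform2.

(** * The Fourier transform of a rectangle *)

Section tensor.
Context (R : realType).
Notation leb := (@lebesgue_measure R).
Implicit Types (f g : measurableTypeR R -> R) (a b c d : R) (u v : plane R -> R).

Definition tens f g (x : plane R) : R := f x.1 * g x.2.

Lemma measurable_tens f g : measurable_fun setT f -> measurable_fun setT g ->
  measurable_fun setT (tens f g).
Proof.
by move=> mf mg; apply: measurable_funM; exact: measurableT_comp.
Qed.

Lemma tens_int f g : L1 leb f -> L1 leb g ->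
  L1 (leb2 R) (tens f g) /\
  \int[leb2 R]_x tens f g x = \int[leb]_x f x * \int[leb]_x g x.
Proof.
move=> If Ig.
have mt := measurable_tens (L1_measurable If) (L1_measurable Ig).
have It : L1 (leb2 R) (tens f g).
  apply/integrable12ltyP; first exact/measurable_EFinP.
  have E x : (\int[leb]_y `|(tens f g (x, y))%:E| =
      (\int[leb]_y `|g y|)%:E * `|f x|%:E)%E.
    rewrite -EFinM mulrC -intZ; last exact: L1_norm.
    rewrite -int_fineK; last exact/L1Z/L1_norm.
    by apply: eq_integral => y _; rewrite /= /tens/= normrM.
  under eq_integral do rewrite E -EFinM.
  rewrite int_fineK ?ltry//; exact/L1Z/L1_norm.
split=> //.
rewrite /Rintegral -integral12_prod_meas1//.
have E x : (\int[leb]_y (tens f g (x, y))%:E = (\int[leb]_y g y * f x)%:E)%E.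
  rewrite mulrC -intZ// -int_fineK; last exact: L1Z.
  exact: eq_integral.
transitivity (\int[leb]_x (\int[leb]_y g y * f x)).
  by congr fine; apply: eq_integral => x _; exact: E.
by rewrite intZ// mulrC.
Qed.

Lemma L2_tens f g : L2 leb f -> L2 leb g -> L2 (leb2 R) (tens f g).
Proof.
move=> [mf If] [mg Ig]; split; first exact: measurable_tens.
have [+ _] := tens_int If Ig; rewrite (_ : tens _ _ = fun x => tens f g x ^+ 2)//.
by apply/funext => x; rewrite /tens exprMn.
Qed.

Lemma ip_tens f g f' g' : L2 leb f -> L2 leb g -> L2 leb f' -> L2 leb g' ->
  ip (leb2 R) (tens f g) (tens f' g') = ip leb f f' * ip leb g g'.
Proof.
move=> Lf Lg Lf' Lg'; have [_ <-] := tens_int (L2M Lf Lf') (L2M Lg Lg').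
by apply: eq_Rintegral => x _; rewrite /tens mulrACA.
Qed.

Definition cosT u (xi : plane R) : R := \int[leb2 R]_x (cos (dotp x xi) * u x).
Definition sinT u (xi : plane R) : R := \int[leb2 R]_x (sin (dotp x xi) * u x).

(** The real part of the Hermitian product of two Fourier transforms. *)
Definition fip u v : R :=
  ip (leb2 R) (cosT u) (cosT v) + ip (leb2 R) (sinT u) (sinT v).

(** Rectangles are half-open so that they generate the Borel sets and are stable
    under intersection. *)
Definition rect a b c d : plane R -> R :=
  tens \1_(`]a, b]%classic) \1_(`]c, d]%classic).

Lemma cosT_rect a b c d : a <= b -> c <= d -> cosT (rect a b c d) =
  fun xi => tens (cos_itv a b) (cos_itv c d) xi
            - tens (sin_itv a b) (sin_itv c d) xi.
Proof.
move=> ab cd; apply/funext => -[s t]; rewrite /cosT /tens/=.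
have [Ic Ec] := cos_itvE s ab; have [Is Es] := sin_itvE s ab.
have [Ic' Ec'] := cos_itvE t cd; have [Is' Es'] := sin_itvE t cd.
have [Icc Ecc] := tens_int Ic Ic'; have [Iss Ess] := tens_int Is Is'.
rewrite -Ec -Es -Ec' -Es' -Ecc -Ess -intB//.
by apply: eq_Rintegral => -[x y] _; rewrite /dotp /rect /tens/= cosD; ring.
Qed.

Lemma sinT_rect a b c d : a <= b -> c <= d -> sinT (rect a b c d) =
  fun xi => tens (sin_itv a b) (cos_itv c d) xi
            + tens (cos_itv a b) (sin_itv c d) xi.
Proof.
move=> ab cd; apply/funext => -[s t]; rewrite /sinT /tens/=.
have [Ic Ec] := cos_itvE s ab; have [Is Es] := sin_itvE s ab.
have [Ic' Ec'] := cos_itvE t cd; have [Is' Es'] := sin_itvE t cd.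
have [Isc Esc] := tens_int Is Ic'; have [Ics Ecs] := tens_int Ic Is'.
rewrite -Ec -Es -Ec' -Es' -Ecs -Esc -intD//.
by apply: eq_Rintegral => -[x y] _; rewrite /dotp /rect /tens/= sinD; ring.
Qed.

Lemma L2_itv a b : L2 leb \1_(`]a, b]%classic).
Proof.
split=> //; rewrite (_ : (fun x => _) = \1_(`]a, b]%classic)).
  exact: integrable_indic_itv.
by apply/funext => x; rewrite indicE; case: (_ \in _); rewrite ?expr1n ?expr0n.
Qed.

Lemma L2_rect a b c d : L2 (leb2 R) (rect a b c d).
Proof. by apply: L2_tens; exact: L2_itv. Qed.

Let L2cc a b c d : L2 (leb2 R) (tens (cos_itv a b) (cos_itv c d)).
Proof. by apply: L2_tens; exact: L2_cos_itv. Qed.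

Let L2ss a b c d : L2 (leb2 R) (tens (sin_itv a b) (sin_itv c d)).
Proof. by apply: L2_tens; exact: L2_sin_itv. Qed.

Let L2sc a b c d : L2 (leb2 R) (tens (sin_itv a b) (cos_itv c d)).
Proof. by apply: L2_tens; [exact: L2_sin_itv|exact: L2_cos_itv]. Qed.

Let L2cs a b c d : L2 (leb2 R) (tens (cos_itv a b) (sin_itv c d)).
Proof. by apply: L2_tens; [exact: L2_cos_itv|exact: L2_sin_itv]. Qed.

Lemma L2_cosT_rect a b c d : a <= b -> c <= d ->
  L2 (leb2 R) (cosT (rect a b c d)).
Proof. by move=> ab cd; rewrite cosT_rect//; exact: L2B. Qed.

Lemma L2_sinT_rect a b c d : a <= b -> c <= d ->
  L2 (leb2 R) (sinT (rect a b c d)).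
Proof. by move=> ab cd; rewrite sinT_rect//; exact: L2D. Qed.

(** The factor in Parseval's identity, [(2 pi)^2] for this normalization of the
    transform. *)
Definition kappa : R := (2 * Ccos R) ^+ 2.

Lemma kappa_gt0 : 0 < kappa.
Proof. by rewrite exprn_gt0// mulr_gt0// Ccos_gt0. Qed.

(** With [z] and [w] the products of conjugate transforms in the two
    variables, the real part of [z w] is [Re z Re w - Im z Im w]. The real parts
    are given by [cos_sin_itv_ip] and the imaginary parts vanish by
    [cos_sin_itv_cross]. *)
Lemma rect_plancherel a b c d a' b' c' d' :
  a <= b -> c <= d -> a' <= b' -> c' <= d' ->
  fip (rect a b c d) (rect a' b' c' d') =
    kappa * ip (leb2 R) (rect a b c d) (rect a' b' c' d').
Proof.
move=> ab cd ab' cd'.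
rewrite [in RHS]ip_tens; try exact: L2_itv.
rewrite !indic_itv_ip// /kappa exprMn.
have E1 := cos_sin_itv_ip ab ab'; have E2 := cos_sin_itv_ip cd cd'.
have E3 := cos_sin_itv_cross a b a' b'.
have S f g : L2 leb f -> L2 leb g -> forall h k, L2 leb h -> L2 leb k ->
   ip (leb2 R) (tens f g) (tens h k) = ip leb f h * ip leb g k.
  by move=> *; exact: ip_tens.
have lc := L2_cos_itv; have ls := L2_sin_itv.
rewrite intB in E3; [|exact: (L2M (ls _ _ _) (lc _ _ _))|exact: (L2M (lc _ _ _) (ls _ _ _))].
rewrite -!/(ip _ _ _) in E3.
rewrite /fip !cosT_rect// !sinT_rect//.
rewrite ipBl//; last exact: L2B.
rewrite !ipBr// ipDl//; last exact: L2D.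
rewrite !ipDr// !S//.
rewrite [RHS](_ : _ = (2 * Ccos R * len_cap a b a' b')
  * (2 * Ccos R * len_cap c d c' d')); last by ring.
have {}E3 : ip leb (cos_itv a b) (sin_itv a' b') =
    ip leb (sin_itv a b) (cos_itv a' b').
  by apply/esym/eqP; rewrite -subr_eq0 E3.
by rewrite -E1 -E2 E3; ring.
Qed.

End tensor.

(** * Density of step functions *)

Section L2_limits.
Context d (T : measurableType d) (R : realType).
Variable mu : {measure set T -> \bar R}.

Lemma cvgL2sq_dct (f_ : nat -> T -> R) (f g : T -> R) :
  (forall n, measurable_fun setT (f_ n)) -> measurable_fun setT f ->
  (forall x, f_ n x @[n --> \oo] --> f x) ->
  (forall n x, `|f_ n x - f x| <= `|g x|) -> L2 mu g -> cvgL2sq mu f_ f.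
Proof.
move=> mf_ mf fc fg [mg Ig].
have [|||_] := @dct _ _ _ mu (fun n x => (f_ n x - f x) ^+ 2) (cst 0) _ _ _ Ig.
- by move=> n; apply: measurable_funX; exact: measurable_funB.
- move=> x; rewrite [X in _ --> X](_ : _ = 0 ^+ 2); last by rewrite expr0n.
  have /subr_cvg0 h := fc x.
  by apply: (cvg_comp _ _ h (@exprn_continuous R 2 0)).
- move=> n x; rewrite ger0_norm ?sqr_ge0//.
  rewrite -(real_normK (num_real (_ - _))) -(real_normK (num_real (g x))).
  by rewrite lerXn2r ?nnegrE.
rewrite /Rintegral integral0/=; apply: cvg_trans.
by under eq_fun do rewrite nsqE.
Qed.

Lemma L2_indic (A : set T) (f : T -> R) : measurable A -> L2 mu f ->
  L2 mu (fun x => f x * \1_A x).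
Proof.
move=> mA Lf; have [mf _] := Lf; apply: L2_le Lf; first exact: measurable_funM.
move=> x; rewrite indicE; case: (_ \in _); first by rewrite mulr1.
by rewrite mulr0 normr0.
Qed.

End L2_limits.

Section step_functions.
Context (R : realType).
Variable r : R.
Notation leb := (@lebesgue_measure R).
Implicit Types (u v s : plane R -> R).

Definition cell : set (plane R) := `]- r, r]%classic `*` `]- r, r]%classic.

Inductive step : (plane R -> R) -> Prop :=
| step0 : step (fun=> 0)
| stepS k a b c d s : - r <= a <= b -> b <= r -> - r <= c <= d -> d <= r ->
    step s -> step (fun x => k * rect a b c d x + s x).

Lemma measurable_cell : measurable cell.
Proof. exact: measurableX. Qed.

Lemma indic_setX (A B : set R) (x : plane R) :
  \1_(A `*` B) x = \1_A x.1 * \1_B x.2 :> R.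
Proof.
rewrite !indicE -natrM mulnb; congr (nat_of_bool _)%:R.
by apply/idP/andP => [/set_mem[]/=|[/set_mem ? /set_mem ?]]; [split|]; apply/mem_set.
Qed.

Lemma rect_indic a b c d (x : plane R) :
  rect a b c d x = \1_(`]a, b]%classic `*` `]c, d]%classic) x.
Proof. by rewrite indic_setX. Qed.

Lemma step_supp s : step s -> forall x, s x * \1_cell x = s x.
Proof.
elim=> [x|k a b c d {}s /andP[ra ab] br /andP[rc cd] dr _ IH x]; first exact: mul0r.
rewrite mulrDl IH; congr (_ + _); rewrite rect_indic !indicE.
have [/set_mem/= [/=]|_] := boolP (x \in _ `*` _); last by rewrite mulr0 mul0r.
rewrite !in_itv/= => /andP[x1 x2] /andP[x3 x4].
rewrite [_ \in cell]mem_set ?mulr1// /cell/=; split => /=; rewrite in_itv/=.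
  by rewrite (le_lt_trans ra) ?(le_trans x2).
by rewrite (le_lt_trans rc) ?(le_trans x4).
Qed.

Lemma L2_step s : step s -> L2 (leb2 R) s.
Proof.
elim=> [|k a b c d {}s _ _ _ _ _ IH]; first exact: L2_0.
by apply: L2D => //; apply: L2Z; exact: L2_rect.
Qed.

Lemma stepD s1 s2 : step s1 -> step s2 -> step (fun x => s1 x + s2 x).
Proof.
move=> + h2; elim=> [|k a b c d s *].
  by under eq_fun do rewrite add0r.
by under eq_fun do rewrite -addrA; apply: stepS.
Qed.

Lemma stepZ k s : step s -> step (fun x => k * s x).
Proof.
elim=> [|k' a b c d {}s *].
  by under eq_fun do rewrite mulr0; exact: step0.
by under eq_fun do rewrite mulrDr mulrA; apply: stepS.
Qed.

Lemma stepB s1 s2 : step s1 -> step s2 -> step (fun x => s1 x - s2 x).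
Proof.
by move=> h1 h2; under eq_fun do rewrite -mulN1r; apply/stepD/stepZ.
Qed.

(** Clipping keeps the linear combination inside the cell: the intersection of a
    rectangle with the cell is a rectangle, possibly empty. *)
Lemma step_rect a b c d :
  step (fun x => rect a b c d x * \1_cell x).
Proof.
pose a' := Num.max a (- r); pose b' := Num.min b r.
pose c' := Num.max c (- r); pose d' := Num.min d r.
have capE x : rect a b c d x * \1_cell x = rect a' b' c' d' x.
  rewrite !rect_indic !indicE -natrM mulnb -in_setI; congr (nat_of_bool (_ \in _))%:R.
  rewrite -setXI; congr (_ `*` _); apply/seteqP;
  by split=> y /=; rewrite !in_itv/= gt_max le_min;
    [move=> [/andP[-> ->] /andP[-> ->]]|move=> /andP[/andP[-> ->] /andP[-> ->]]].
under eq_fun do rewrite capE.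
have [ab|ab] := ltP b' a'.
  rewrite (_ : rect _ _ _ _ = fun=> 0); first exact: step0.
  apply/funext => x; rewrite rect_indic (_ : `]a', b']%classic = set0) ?set0X ?indic0//.
  by apply: set_itv_ge; rewrite bnd_simp -leNgt ltW.
have [cd|cd] := ltP d' c'.
  rewrite (_ : rect _ _ _ _ = fun=> 0); first exact: step0.
  apply/funext => x; rewrite rect_indic (_ : `]c', d']%classic = set0) ?setX0 ?indic0//.
  by apply: set_itv_ge; rewrite bnd_simp -leNgt ltW.
rewrite (_ : rect _ _ _ _ = fun x => 1 * rect a' b' c' d' x + 0); last first.
  by apply/funext => x; rewrite mul1r addr0.
by apply: stepS; rewrite ?ab ?cd ?le_max ?ge_min ?lexx ?orbT//; exact: step0.
Qed.

(** The closure in L^2 of the step functions supported in the cell. The support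
    condition is part of the definition since it is what makes these functions
    integrable, with a transform given by an integral. *)
Definition step_closure u : Prop := [/\ L2 (leb2 R) u,
  forall x, u x * \1_cell x = u x &
  forall e, 0 < e -> exists2 s, step s & nsq (leb2 R) (fun x => u x - s x) < e].

Lemma step_closure_step s : step s -> step_closure s.
Proof.
move=> hs; split; [exact: L2_step|exact: step_supp|move=> e e0].
exists s => //; rewrite /nsq /ip; under eq_Rintegral do rewrite subrr mul0r.
by rewrite /Rintegral integral0.
Qed.

Lemma step_closureD u v : step_closure u -> step_closure v -> step_closure (fun x => u x + v x).
Proof.
move=> [Lu Su Au] [Lv Sv Av]; split; [exact: L2D|by move=> x; rewrite mulrDl Su Sv|].
move=> e e0; have e4 : 0 < e / 4 by rewrite divr_gt0.
have [s hs us] := Au _ e4; have [t ht vt] := Av _ e4.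
exists (fun x => s x + t x); first exact: stepD.
rewrite (_ : (fun x => _) = fun x => (u x - s x) + (v x - t x)); last first.
  by apply/funext => x; ring.
have Lus := L2B Lu (L2_step hs); have Lvt := L2B Lv (L2_step ht).
by apply: le_lt_trans (nsqD_le Lus Lvt) _; lra.
Qed.

Lemma step_closureZ k u : step_closure u -> step_closure (fun x => k * u x).
Proof.
move=> [Lu Su Au]; split; [exact: L2Z|by move=> x; rewrite -mulrA Su|].
move=> e e0; have k0 : 0 < k ^+ 2 + 1 by rewrite ltr_wpDl// sqr_ge0.
have [|s hs us] := Au (e / (k ^+ 2 + 1)); first by rewrite divr_gt0.
exists (fun x => k * s x); first exact: stepZ.
rewrite (_ : (fun x => _) = fun x => k * (u x - s x)); last first.
  by apply/funext => x; ring.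
rewrite nsqZ; last exact: L2B Lu (L2_step hs).
move: us; rewrite ltr_pdivlMr//; have := nsq_ge0 (leb2 R) (fun x => u x - s x).
by nra.
Qed.

Lemma step_closureB u v : step_closure u -> step_closure v -> step_closure (fun x => u x - v x).
Proof.
by move=> h1 h2; under eq_fun do rewrite -mulN1r; apply/step_closureD/step_closureZ.
Qed.

Lemma step_closure_cvg (u_ : nat -> plane R -> R) u :
  (forall n, step_closure (u_ n)) -> L2 (leb2 R) u -> (forall x, u x * \1_cell x = u x) ->
  cvgL2sq (leb2 R) u_ u -> step_closure u.
Proof.
move=> Au_ Lu Su c; split=> // e e0; have e4 : 0 < e / 4 by rewrite divr_gt0.
have /cvgrPdist_lt/(_ _ e4)[n _ /(_ n (leqnn n))/=] := c.
rewrite sub0r normrN ger0_norm ?nsq_ge0// nsqBC => hn.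
have [Ln Sn /(_ _ e4)[s hs us]] := Au_ n; exists s => //.
rewrite (_ : (fun x => _) = fun x => (u x - u_ n x) + (u_ n x - s x)); last first.
  by apply/funext => x; ring.
apply: (le_lt_trans (nsqD_le (L2B Lu Ln) (L2B Ln (L2_step hs)))).
by lra.
Qed.

Lemma step_closure_sum I (l : seq I) (F : I -> plane R -> R) :
  (forall i, step_closure (F i)) -> step_closure (fun x => \sum_(i <- l) F i x).
Proof.
move=> AF; elim: l => [|i l IH].
  by under eq_fun do rewrite big_nil; exact/step_closure_step/step0.
by under eq_fun do rewrite big_cons; exact: step_closureD.
Qed.

(** Pulling back a generating pi-system along [phi]: the sets whose indicator,
    multiplied by a fixed approximable weight, is approximable form a Dynkin
    system. *)
Lemma step_closure_dynkin d (X : measurableType d) (G : set (set X))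
    (phi : plane R -> X) (w : plane R -> R) :
  @measurable _ X = <<s G >> -> setI_closed G ->
  measurable_fun setT phi -> step_closure w ->
  (forall A, G A -> step_closure (fun x => w x * \1_A (phi x))) ->
  forall A, measurable A -> step_closure (fun x => w x * \1_A (phi x)).
Proof.
move=> mG GI mphi Aw AG A mA; have [Lw Sw _] := Aw.
have LA B : measurable B -> L2 (leb2 R) (fun x => w x * \1_B (phi x)).
  move=> mB; have := @L2_indic _ _ _ (leb2 R) (phi @^-1` B) w _ Lw.
  by apply; rewrite -[X in measurable X]setTI; exact: mphi.
have SA B x : w x * \1_B (phi x) * \1_cell x = w x * \1_B (phi x).
  by rewrite mulrAC Sw.
suff: <<s G >> A -> step_closure (fun x => w x * \1_A (phi x)) by apply; rewrite -mG.
apply: (@dynkin_induction _ X G (fun B => step_closure (fun x => w x * \1_B (phi x)))) => //.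
- by under eq_fun do rewrite indicT mulr1.
- move=> S mS AS.
  rewrite (_ : (fun x => _) = fun x => w x - w x * \1_S (phi x)); last first.
    apply/funext => x; rewrite !indicE in_setC.
    by case: (_ \in S); rewrite /= ?mulr1 ?mulr0 ?subrr ?subr0.
  exact: step_closureB.
- move=> F mF tF AF.
  have mU : measurable (\bigcup_k F k) by exact: bigcup_measurable.
  (* By disjointness the partial sums are pointwise [w x] from the index of the
     set that contains [phi x] on, and 0 if there is none. *)
  have inF k x n : F k (phi x) ->
      \sum_(i < n) w x * \1_(F i) (phi x) = if (k < n)%N then w x else 0.
    move=> Fk; have E i : \1_(F i) (phi x) = (i == k)%:R :> R.
      rewrite indicE; congr (nat_of_bool _)%:R; apply/idP/eqP => [/set_mem Fi|->].
        by apply: tF => //; exists (phi x).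
      exact/mem_set.
    elim: n => [|n IH]; first by rewrite big_ord0.
    rewrite big_ord_recr/= IH E ltnS; case: ltngtP => // _; rewrite ?mulr0 ?addr0//.
    by rewrite mulr1 add0r.
  have notinF x n : ~ (\bigcup_k F k) (phi x) ->
      \sum_(i < n) w x * \1_(F i) (phi x) = 0.
    move=> nF; apply: big1 => i _; rewrite indicE memNset ?mulr0// => Fi.
    by apply: nF; exists i.
  apply: (@step_closure_cvg (fun n x => \sum_(i < n) w x * \1_(F i) (phi x))).
  + by move=> n; exact: step_closure_sum.
  + exact: LA.
  + exact: SA.
  + apply: (cvgL2sq_dct (g := w)) => //.
    * move=> n; apply: measurable_sum => i.
      by have [] := LA _ (mF i).
    * by case: (LA _ mU).
    * move=> x; have [[k _ Fk]|nF] := pselect ((\bigcup_k F k) (phi x)).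
        rewrite indicE mem_set ?mulr1; last by exists k.
        apply: cvg_near_cst; exists k.+1 => // n /= kn.
        by rewrite (inF k)// kn.
      rewrite indicE memNset// mulr0.
      by apply: cvg_near_cst; apply: nearW => n; rewrite notinF.
    * move=> n x; have [[k _ Fk]|nF] := pselect ((\bigcup_k F k) (phi x)).
        rewrite (inF k)// indicE mem_set ?mulr1; last by exists k.
        by case: ifP => _; rewrite ?subrr ?normr0// sub0r normrN.
      by rewrite notinF// indicE memNset// mulr0 subrr normr0.
Qed.

End step_functions.

Section density.
Context (R : realType).
Variable r : R.
Notation leb := (@lebesgue_measure R).
Notation cell := (cell r).
Notation step_closure := (step_closure r).
Implicit Types (u v s : plane R -> R).

Let ocitv_gen : @measurable _ (measurableTypeR R) = <<s @ocitv R >>.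
Proof. by []. Qed.

Let closure_ocitv (a b c d : R) : step_closure
  (fun x => \1_cell x * \1_(`]c, d]%classic) x.2 * \1_(`]a, b]%classic) x.1).
Proof.
rewrite (_ : (fun x => _) = fun x => rect a b c d x * \1_cell x).
  exact/step_closure_step/step_rect.
by apply/funext => x; rewrite /rect /tens; ring.
Qed.

Let cell_r (x : plane R) : \1_cell x * \1_(`]- r, r]%classic) x.1 = \1_cell x :> R.
Proof.
rewrite indic_setX mulrAC; congr (_ * _).
by rewrite indicE; case: (_ \in _); rewrite ?mulr1 ?mulr0.
Qed.

Let cell_r2 (x : plane R) : \1_cell x * \1_(`]- r, r]%classic) x.2 = \1_cell x :> R.
Proof.
rewrite indic_setX -mulrA; congr (_ * _).
by rewrite indicE; case: (_ \in _); rewrite ?mulr1 ?mulr0.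
Qed.

Lemma step_closure_cell : step_closure \1_cell.
Proof.
have := closure_ocitv (- r) r (- r) r.
by under eq_fun do rewrite cell_r2 cell_r.
Qed.

(** The intervals are replaced by Borel sets in one variable at a time, and then
    the products of Borel sets by Borel sets of the plane. *)
Let closure_half (A : set (measurableTypeR R)) (c d : R) : measurable A ->
  step_closure (fun x => \1_cell x * \1_(`]c, d]%classic) x.2 * \1_A x.1).
Proof.
apply: (@step_closure_dynkin _ _ _ _ _ fst (fun x => \1_cell x * \1_(`]c, d]%classic) x.2) ocitv_gen).
- exact: ocitvI.
- exact: measurable_fst.
- have := closure_ocitv (- r) r c d.
  by under eq_fun do rewrite mulrAC cell_r.
- by move=> _ [[a b] _ <-]; exact: closure_ocitv.
Qed.

Let closure_rect (A B : set (measurableTypeR R)) : measurable A -> measurable B ->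
  step_closure (fun x => \1_cell x * \1_A x.1 * \1_B x.2).
Proof.
move=> mA; apply: (@step_closure_dynkin _ _ _ _ _ snd (fun x => \1_cell x * \1_A x.1) ocitv_gen).
- exact: ocitvI.
- exact: measurable_snd.
- have := closure_half (- r) r mA.
  by under eq_fun do rewrite cell_r2.
- move=> _ [[c d] _ <-]; have := closure_half c d mA.
  by under eq_fun do rewrite mulrAC.
Qed.

Lemma step_closure_indic (E : set (plane R)) : measurable E ->
  step_closure (fun x => \1_cell x * \1_E x).
Proof.
apply: (@step_closure_dynkin _ _ _ _ _ id \1_cell (measurable_prod_measurableType _ _)).
- move=> _ _ [A mA [B mB <-]] [A' mA' [B' mB' <-]]; rewrite -setXI.
  by exists (A `&` A'); [exact: measurableI|exists (B `&` B') => //; exact: measurableI].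
- exact: measurable_id.
- exact: step_closure_cell.
- move=> _ [A mA [B mB <-]]; under eq_fun do rewrite (indic_setX A B) mulrA.
  exact: closure_rect.
Qed.

Import HBNNSimple.

Lemma L2_cell u : L2 (leb2 R) u -> L2 (leb2 R) (fun x => u x * \1_cell x).
Proof. by apply: L2_indic; exact: measurable_cell. Qed.

Let closure_ge0 u : L2 (leb2 R) u -> (forall x, 0 <= u x) ->
  step_closure (fun x => u x * \1_cell x).
Proof.
move=> Lu u0; have [mu _] := Lu.
have meu : measurable_fun setT (EFin \o u) by exact/measurable_EFinP.
have eu0 x : (0 <= (EFin \o u) x)%E by rewrite lee_fin.
pose g := nnsfun_approx measurableT meu.
apply: (@step_closure_cvg R r (fun n x => g n x * \1_cell x) (fun x => u x * \1_cell x)).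
- move=> n; under eq_fun do rewrite fimfunEord mulr_suml.
  apply: step_closure_sum => i; under eq_fun do rewrite -mulrA (mulrC (\1_ _ _)).
  by apply/step_closureZ/step_closure_indic.
- exact: L2_cell.
- by move=> x; rewrite -mulrA !indicE; case: (_ \in _); rewrite ?mulr1 ?mulr0.
apply: (cvgL2sq_dct (g := u)) => //.
- by move=> n; apply: measurable_funM => //; apply: measurable_indic; exact: measurable_cell.
- by apply: measurable_funM => //; apply: measurable_indic; exact: measurable_cell.
- move=> x; apply: cvgM; last exact: cvg_cst.
  by have /fine_cvg := cvg_nnsfun_approx measurableT meu (fun x _ => eu0 x) (x := x) I.
- move=> n x; have gu : g n x <= u x.
    by rewrite -lee_fin /g nnsfun_approxE; apply: le_approx.
  have g0 : 0 <= g n x by exact: fun_ge0.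
  rewrite -mulrBl indicE; case: (_ \in _); last by rewrite mulr0 normr0.
  rewrite mulr1 distrC ger0_norm ?subr_ge0// ger0_norm// ?(le_trans g0)//.
  by rewrite gerBl.
Qed.

(** Step functions are dense in the square-integrable functions of the cell. *)
Lemma step_closure_L2 u : L2 (leb2 R) u -> step_closure (fun x => u x * \1_cell x).
Proof.
move=> Lu; have [mu Iu] := Lu.
pose up x := Num.max (u x) 0; pose un x := Num.max (- u x) 0.
have Lp : L2 (leb2 R) up.
  apply: L2_le Lu; first exact: measurable_maxr.
  by move=> x; rewrite /up; case: (leP (u x) 0) => h; rewrite ?normr0.
have Ln : L2 (leb2 R) un.
  apply: L2_le Lu; first by apply: measurable_maxr => //; exact: measurable_funN.
  by move=> x; rewrite /un; case: (leP (- u x) 0) => h; rewrite ?normr0 ?normrN.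
rewrite (_ : (fun x => _) = fun x => up x * \1_cell x - un x * \1_cell x).
  by apply: step_closureB; apply: closure_ge0 => // x; rewrite le_max lexx orbT.
apply/funext => x; rewrite -mulrBl; congr (_ * _); rewrite /up /un.
by case: (leP (u x) 0) => h1; case: (leP (- u x) 0) => h2; lra.
Qed.

End density.

(** * Plancherel's theorem *)

Section fourier_L1.
Context (R : realType).
Implicit Types (u v : plane R -> R) (xi x : plane R).

Lemma measurable_dotp xi : measurable_fun setT (fun x : plane R => dotp x xi).
Proof.
by apply: measurable_funD; exact: measurable_funM.
Qed.

Lemma L1_cos u xi : L1 (leb2 R) u -> L1 (leb2 R) (fun x => cos (dotp x xi) * u x).
Proof.
move=> Iu; apply: (L1_le _ _ (L1_norm Iu)).
  apply: measurable_funM; last exact: L1_measurable Iu.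
  apply: (measurableT_comp (f := @cos R)) (measurable_dotp xi).
  exact: (continuous_measurable_fun (@continuous_cos R)).
by move=> x; rewrite normrM ler_piMl ?cos_max.
Qed.

Lemma L1_sin u xi : L1 (leb2 R) u -> L1 (leb2 R) (fun x => sin (dotp x xi) * u x).
Proof.
move=> Iu; apply: (L1_le _ _ (L1_norm Iu)).
  apply: measurable_funM; last exact: L1_measurable Iu.
  apply: (measurableT_comp (f := @sin R)) (measurable_dotp xi).
  exact: (continuous_measurable_fun (@continuous_sin R)).
by move=> x; rewrite normrM ler_piMl ?sin_max.
Qed.

Lemma cosT_linear k u v : L1 (leb2 R) u -> L1 (leb2 R) v ->
  cosT (fun x => k * u x + v x) = fun xi => k * cosT u xi + cosT v xi.
Proof.
move=> Iu Iv; apply/funext => xi; rewrite /cosT -intZ; last exact: L1_cos.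
rewrite -intD; [|exact/L1Z/L1_cos|exact: L1_cos].
by apply: eq_Rintegral => x _; ring.
Qed.

Lemma sinT_linear k u v : L1 (leb2 R) u -> L1 (leb2 R) v ->
  sinT (fun x => k * u x + v x) = fun xi => k * sinT u xi + sinT v xi.
Proof.
move=> Iu Iv; apply/funext => xi; rewrite /sinT -intZ; last exact: L1_sin.
rewrite -intD; [|exact/L1Z/L1_sin|exact: L1_sin].
by apply: eq_Rintegral => x _; ring.
Qed.

Lemma cosTB u v : L1 (leb2 R) u -> L1 (leb2 R) v ->
  cosT (fun x => u x - v x) = fun xi => cosT u xi - cosT v xi.
Proof.
move=> Iu Iv; apply/funext => xi; rewrite /cosT -intB; try exact: L1_cos.
by apply: eq_Rintegral => x _; ring.
Qed.

Lemma sinTB u v : L1 (leb2 R) u -> L1 (leb2 R) v ->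
  sinT (fun x => u x - v x) = fun xi => sinT u xi - sinT v xi.
Proof.
move=> Iu Iv; apply/funext => xi; rewrite /sinT -intB; try exact: L1_sin.
by apply: eq_Rintegral => x _; ring.
Qed.

Lemma cosT_le u xi : L1 (leb2 R) u -> `|cosT u xi| <= \int[leb2 R]_x `|u x|.
Proof.
move=> Iu; apply: le_trans (le_norm_int (L1_cos xi Iu)) _.
apply: le_int; [exact/L1_norm/L1_cos|exact: L1_norm|move=> x].
by rewrite normrM ler_piMl ?cos_max.
Qed.

Lemma sinT_le u xi : L1 (leb2 R) u -> `|sinT u xi| <= \int[leb2 R]_x `|u x|.
Proof.
move=> Iu; apply: le_trans (le_norm_int (L1_sin xi Iu)) _.
apply: le_int; [exact/L1_norm/L1_sin|exact: L1_norm|move=> x].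
by rewrite normrM ler_piMl ?sin_max.
Qed.

End fourier_L1.

Section plancherel_cell.
Context (R : realType).
Variable r : R.
Notation cell := (cell r).
Notation step := (step r).
Notation step_closure := (step_closure r).
Implicit Types (u v s t : plane R -> R).

Let L2_1cell : L2 (leb2 R) \1_cell.
Proof. by have [] := step_closure_cell r. Qed.

(** Cauchy-Schwarz against the indicator of the cell. *)
Lemma cell_L1 u : L2 (leb2 R) u -> (forall x, u x * \1_cell x = u x) ->
  L1 (leb2 R) u /\
  \int[leb2 R]_x `|u x| <= Num.sqrt (nsq (leb2 R) u) * Num.sqrt (nsq (leb2 R) \1_cell).
Proof.
move=> Lu Su; have := L2M Lu L2_1cell; under eq_fun do rewrite Su.
move=> Iu; split=> //.
have Lnu : L2 (leb2 R) (fun x => `|u x|).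
  apply: L2_le Lu; last by move=> x; rewrite normr_id.
  exact: measurableT_comp (L1_measurable Iu).
have -> : \int[leb2 R]_x `|u x| = ip (leb2 R) (fun x => `|u x|) \1_cell.
  apply: eq_Rintegral => x _; rewrite -{1}Su normrM; congr (_ * _).
  by rewrite indicE; case: (_ \in _); rewrite ?normr1 ?normr0.
apply: le_trans (ler_norm _) _; apply: le_trans (ip_norm_le Lnu L2_1cell) _.
rewrite le_eqVlt; apply/orP; left; apply/eqP; congr (Num.sqrt _ * _).
by apply: eq_Rintegral => x _; rewrite -normrM -expr2 ger0_norm ?sqr_ge0.
Qed.

Lemma step_L1 s : step s -> L1 (leb2 R) s.
Proof. by move=> hs; have [] := cell_L1 (L2_step hs) (step_supp hs). Qed.

Lemma rect_L1 a b c d : L1 (leb2 R) (rect a b c d : plane R -> R).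
Proof. by have [] := tens_int (integrable_indic_itv a b false false)
  (integrable_indic_itv c d false false). Qed.

Lemma cosT0 : cosT (fun=> 0 : R) = fun=> 0.
Proof.
apply/funext => xi; rewrite /cosT; under eq_Rintegral do rewrite mulr0.
by rewrite /Rintegral integral0.
Qed.

Lemma sinT0 : sinT (fun=> 0 : R) = fun=> 0.
Proof.
apply/funext => xi; rewrite /sinT; under eq_Rintegral do rewrite mulr0.
by rewrite /Rintegral integral0.
Qed.

Lemma step_L2T s : step s -> L2 (leb2 R) (cosT s) /\ L2 (leb2 R) (sinT s).
Proof.
elim=> [|k a b c d {}s /andP[_ ab] _ /andP[_ cd] _ hs [IHc IHs]].
  by rewrite cosT0 sinT0; split; exact: L2_0.
have Is := step_L1 hs; have Ir := rect_L1 a b c d.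
rewrite cosT_linear// sinT_linear//; split; apply: L2D => //; apply: L2Z.
  exact: L2_cosT_rect.
exact: L2_sinT_rect.
Qed.

Let ip0 u : ip (leb2 R) (fun=> 0) u = 0.
Proof.
by rewrite /ip; under eq_Rintegral do rewrite mul0r; rewrite /Rintegral integral0.
Qed.

Let fip_lin k u v w :
  L1 (leb2 R) u -> L1 (leb2 R) v ->
  L2 (leb2 R) (cosT u) -> L2 (leb2 R) (sinT u) ->
  L2 (leb2 R) (cosT v) -> L2 (leb2 R) (sinT v) ->
  L2 (leb2 R) (cosT w) -> L2 (leb2 R) (sinT w) ->
  fip (fun x => k * u x + v x) w = k * fip u w + fip v w.
Proof.
move=> Iu Iv cu su cv sv cw sw; rewrite /fip cosT_linear// sinT_linear//.
rewrite (ipDl (L2Z k cu) cv cw) (ipDl (L2Z k su) sv sw).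
by rewrite (ipZl k cu cw) (ipZl k su sw) mulrDr addrACA.
Qed.

Let fipC u v : fip u v = fip v u.
Proof. by rewrite /fip ipC (ipC _ (sinT u)). Qed.

Lemma step_plancherel s t : step s -> step t ->
  fip s t = kappa R * ip (leb2 R) s t.
Proof.
move=> hs ht.
have [tc ts] := step_L2T ht; have Lt := L2_step ht.
elim: hs => [|k a b c d {}s /andP[_ ab] _ /andP[_ cd] _ hs IH].
  by rewrite /fip cosT0 sinT0 !ip0 mulr0 addr0.
have Is := step_L1 hs; have Ir := rect_L1 a b c d.
have rc := L2_cosT_rect ab cd; have rs := L2_sinT_rect ab cd.
have [sc ss] := step_L2T hs.
have Lr := L2_rect a b c d; have Ls := L2_step hs.
rewrite fip_lin// IH (ipDl (L2Z k Lr) Ls Lt).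
rewrite (ipZl k Lr Lt) [RHS]mulrDr; congr (_ + _); rewrite [RHS]mulrCA; congr (_ * _).
rewrite fipC ipC; elim: ht => [|k' a' b' c' d' {tc ts Lt IH}t' /andP[_ ab'] _ /andP[_ cd'] _ ht IH].
  by rewrite /fip cosT0 sinT0 !ip0 mulr0 addr0.
have It := step_L1 ht; have Ir' := rect_L1 a' b' c' d'.
have rc' := L2_cosT_rect ab' cd'; have rs' := L2_sinT_rect ab' cd'.
have [tc ts] := step_L2T ht.
have Lr' := L2_rect a' b' c' d'; have Lt := L2_step ht.
rewrite fip_lin// IH (ipDl (L2Z k' Lr') Lt Lr).
rewrite (ipZl k' Lr' Lr) [RHS]mulrDr; congr (_ + _); rewrite [RHS]mulrCA; congr (_ * _).
exact: rect_plancherel.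
Qed.

(** An isometry on the step functions extends to their closure; that its value
    there is still given by the integral formula follows from Fatou's lemma,
    since that formula is pointwise continuous for the L^1 norm. *)
Lemma step_closure_seq u : step_closure u -> exists s_ : nat -> plane R -> R,
  [/\ forall n, step (s_ n), cvgL2sq (leb2 R) s_ u,
      L2 (leb2 R) (cosT u) /\ L2 (leb2 R) (sinT u),
      cvgL2sq (leb2 R) (fun n => cosT (s_ n)) (cosT u) &
      cvgL2sq (leb2 R) (fun n => sinT (s_ n)) (sinT u)].
Proof.
move=> [Lu Su Au].
have [s_ hs us] : exists2 s_ : nat -> plane R -> R, (forall n, step (s_ n)) &
    forall n, nsq (leb2 R) (fun x => u x - s_ n x) < n.+1%:R^-1.
  have H n : exists s, step s /\ nsq (leb2 R) (fun x => u x - s x) < n.+1%:R^-1.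
    by have [|s ? ?] := Au n.+1%:R^-1; [rewrite invr_gt0|exists s].
  by have [s_ hs_] := choice H; exists s_ => n; case: (hs_ n).
have Ls n := L2_step (hs n); have Is n := step_L1 (hs n).
have [Iu _] := cell_L1 Lu Su.
have cs : cvgL2sq (leb2 R) s_ u.
  apply: (@squeeze_cvgr _ _ _ _ (cst 0) (fun n => n.+1%:R^-1)).
  - by apply: nearW => n /=; rewrite nsq_ge0 nsqBC ltW.
  - exact: cvg_cst.
  - exact: cvg_harmonic.
have intc : \int[leb2 R]_x `|s_ n x - u x| @[n --> \oo] --> (0 : R).
  apply: (@squeeze_cvgr _ _ _ _ (cst 0) (fun n => Num.sqrt (nsq (leb2 R)
    (fun x => s_ n x - u x)) * Num.sqrt (nsq (leb2 R) \1_cell))).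
  - apply: nearW => n /=; apply/andP; split.
      by apply: Rintegral_ge0 => x _; exact: normr_ge0.
    have [] // := @cell_L1 (fun x => s_ n x - u x); first exact: L2B.
    by move=> x; rewrite mulrBl Su step_supp.
  - exact: cvg_cst.
  - rewrite -[X in _ --> X](mul0r (Num.sqrt (nsq (leb2 R) \1_cell))).
    apply: cvgM; last exact: cvg_cst.
    rewrite -[X in _ --> X](@sqrtr0 R).
    have cs' := cs; rewrite /cvgL2sq in cs'.
    by apply: (cvg_comp _ _ cs'); exact: sqrt_continuous.
have cptc xi : cosT (s_ n) xi @[n --> \oo] --> cosT u xi.
  apply/subr_cvg0/norm_cvg0P.
  apply: (@squeeze_cvgr _ _ _ _ (cst 0) (fun n => \int[leb2 R]_x `|s_ n x - u x|)) => //.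
    apply: nearW => n /=; rewrite normr_ge0/=.
    have := @cosT_le R (fun x => s_ n x - u x) xi; rewrite cosTB//.
    by apply; exact: L1B.
  exact: cvg_cst.
have cpts xi : sinT (s_ n) xi @[n --> \oo] --> sinT u xi.
  apply/subr_cvg0/norm_cvg0P.
  apply: (@squeeze_cvgr _ _ _ _ (cst 0) (fun n => \int[leb2 R]_x `|s_ n x - u x|)) => //.
    apply: nearW => n /=; rewrite normr_ge0/=.
    have := @sinT_le R (fun x => s_ n x - u x) xi; rewrite sinTB//.
    by apply; exact: L1B.
  exact: cvg_cst.
have mc : measurable_fun setT (cosT u).
  apply: (@measurable_fun_cvg _ _ _ _ (fun n => cosT (s_ n))).
    by move=> n; have [[]] := step_L2T (hs n).
  by move=> xi _; exact: cptc.
have ms : measurable_fun setT (sinT u).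
  apply: (@measurable_fun_cvg _ _ _ _ (fun n => sinT (s_ n))).
    by move=> n; have [_ []] := step_L2T (hs n).
  by move=> xi _; exact: cpts.
have k0 : 0 <= kappa R by exact/ltW/kappa_gt0.
(* For fixed [k], Fatou's lemma as [j] tends to infinity bounds the distance of
   the transforms of [s_ k] and [u] by that of [s_ k] and [s_ (k + j)], which is
   known because both are step functions. *)
pose D k xi := (cosT (s_ k) xi - cosT u xi) ^+ 2 + (sinT (s_ k) xi - sinT u xi) ^+ 2.
have HD k : L1 (leb2 R) (D k) /\ \int[leb2 R]_xi D k xi <= kappa R * (4 * k.+1%:R^-1).
  pose E j xi := cosT (fun x => s_ k x - s_ (k + j)%N x) xi ^+ 2
    + sinT (fun x => s_ k x - s_ (k + j)%N x) xi ^+ 2.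
  have hd j : step (fun x => s_ k x - s_ (k + j)%N x) by exact: stepB.
  have [dc ds] : (forall j, L2 (leb2 R) (cosT (fun x => s_ k x - s_ (k + j)%N x))) /\
      (forall j, L2 (leb2 R) (sinT (fun x => s_ k x - s_ (k + j)%N x))).
    by split=> j; have [] := step_L2T (hd j).
  apply: (@fatou_le _ _ _ (leb2 R) E).
  - by move=> j; apply: L1D; [have [] := dc j|have [] := ds j].
  - by move=> j xi; rewrite addr_ge0 ?sqr_ge0.
  - move=> xi; rewrite /E /D.
    have -> : (fun j => cosT (fun x => s_ k x - s_ (k + j)%N x) xi ^+ 2
       + sinT (fun x => s_ k x - s_ (k + j)%N x) xi ^+ 2) =
      (fun j => (cosT (s_ k) xi - cosT (s_ (j + k)%N) xi) ^+ 2
       + (sinT (s_ k) xi - sinT (s_ (j + k)%N) xi) ^+ 2).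
      by apply/funext => j; rewrite cosTB// sinTB// addnC.
    have shift (f : nat -> R) (l : R) : f n @[n --> \oo] --> l -> f (n + k)%N @[n --> \oo] --> l.
      by move=> fl; have := fl; rewrite -(cvg_shiftn k).
    have hc := cvgB (cvg_cst (cosT (s_ k) xi)) (shift _ _ (cptc xi)).
    have hs' := cvgB (cvg_cst (sinT (s_ k) xi)) (shift _ _ (cpts xi)).
    have sqc (f : nat -> R) (l : R) : f n @[n --> \oo] --> l ->
        f n ^+ 2 @[n --> \oo] --> l ^+ 2.
      by move=> h; apply: (cvg_comp _ _ h (@exprn_continuous R 2 l)).
    by apply: cvgD; apply: sqc; [exact: hc|exact: hs'].
  - move=> j; rewrite intD; [|by have [] := dc j|by have [] := ds j].
    rewrite -!nsqE -[leLHS]/(fip _ _) step_plancherel// ler_wpM2l//.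
    rewrite (_ : (fun x => _) = fun x => (u x - s_ (k + j)%N x) - (u x - s_ k x)); last first.
      by apply/funext => x; ring.
    apply: le_trans (nsqB_le (L2B Lu (Ls _)) (L2B Lu (Ls _))) _.
    have := us k; have := us (k + j)%N.
    have : (k + j).+1%:R^-1 <= k.+1%:R^-1 :> R.
      by rewrite lef_pV2 ?posrE// ler_nat ltnS leq_addr.
    move: (k.+1%:R^-1) ((k + j).+1%:R^-1) => p q.
    by move: (nsq _ _) (nsq _ _) => X Y; lra.
have lim0 : kappa R * (4 * n.+1%:R^-1) @[n --> \oo] --> (0 : R).
  rewrite -[X in _ --> X](mulr0 (kappa R)); apply: cvgM; first exact: cvg_cst.
  rewrite -[X in _ --> X](mulr0 (4 : R)); apply: cvgM; first exact: cvg_cst.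
  exact: cvg_harmonic.
have Lc n : L2 (leb2 R) (fun xi => cosT (s_ n) xi - cosT u xi).
  have mcn : measurable_fun setT (fun xi => cosT (s_ n) xi - cosT u xi).
    by apply: measurable_funB => //; have [[]] := step_L2T (hs n).
  split=> //; apply: (L1_le _ _ (HD n).1); first exact: measurable_funX.
  by move=> xi; rewrite ger0_norm ?sqr_ge0// lerDl sqr_ge0.
have Lsn n : L2 (leb2 R) (fun xi => sinT (s_ n) xi - sinT u xi).
  have msn : measurable_fun setT (fun xi => sinT (s_ n) xi - sinT u xi).
    by apply: measurable_funB => //; have [_ []] := step_L2T (hs n).
  split=> //; apply: (L1_le _ _ (HD n).1); first exact: measurable_funX.
  by move=> xi; rewrite ger0_norm ?sqr_ge0// lerDr sqr_ge0.
have le0 n : nsq (leb2 R) (fun xi => cosT (s_ n) xi - cosT u xi) +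
    nsq (leb2 R) (fun xi => sinT (s_ n) xi - sinT u xi) <=
    kappa R * (4 * n.+1%:R^-1).
  rewrite !nsqE -intD; first exact: (HD n).2.
    by case: (Lc n).
  by case: (Lsn n).
exists s_; split=> //.
- have [c0 s0] := step_L2T (hs 0%N); split.
    rewrite (_ : cosT u = fun xi => cosT (s_ 0%N) xi - (cosT (s_ 0%N) xi - cosT u xi)).
      exact: L2B.
    by apply/funext => xi; ring.
  rewrite (_ : sinT u = fun xi => sinT (s_ 0%N) xi - (sinT (s_ 0%N) xi - sinT u xi)).
    exact: L2B.
  by apply/funext => xi; ring.
- apply: (@squeeze_cvgr _ _ _ _ (cst 0) (fun n => kappa R * (4 * n.+1%:R^-1))) => //.
    apply: nearW => n /=; rewrite nsq_ge0/=; apply: le_trans (le0 n).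
    by rewrite lerDl nsq_ge0.
  exact: cvg_cst.
- apply: (@squeeze_cvgr _ _ _ _ (cst 0) (fun n => kappa R * (4 * n.+1%:R^-1))) => //.
    apply: nearW => n /=; rewrite nsq_ge0/=; apply: le_trans (le0 n).
    by rewrite lerDr nsq_ge0.
  exact: cvg_cst.
Qed.

(** Plancherel's theorem for square-integrable functions supported in the cell. *)
Lemma plancherel_cell u v : L2 (leb2 R) u -> L2 (leb2 R) v ->
  [/\ L2 (leb2 R) (cosT (fun x => u x * \1_cell x)),
      L2 (leb2 R) (sinT (fun x => u x * \1_cell x)) &
      fip (fun x => u x * \1_cell x) (fun x => v x * \1_cell x) =
      kappa R * ip (leb2 R) (fun x => u x * \1_cell x) (fun x => v x * \1_cell x)].
Proof.
move=> Lu Lv.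
have [s_ [hs su [cu ru] cs ss]] := step_closure_seq (step_closure_L2 r Lu).
have [t_ [ht tv [cv rv] ct st]] := step_closure_seq (step_closure_L2 r Lv).
split=> //; have Ls n := L2_step (hs n); have Lt n := L2_step (ht n).
have Lsc n : L2 (leb2 R) (cosT (s_ n)) by have [] := step_L2T (hs n).
have Lss n : L2 (leb2 R) (sinT (s_ n)) by have [] := step_L2T (hs n).
have Ltc n : L2 (leb2 R) (cosT (t_ n)) by have [] := step_L2T (ht n).
have Lts n : L2 (leb2 R) (sinT (t_ n)) by have [] := step_L2T (ht n).
have l1 := ip_cvg Ls Lt (L2_cell r Lu) (L2_cell r Lv) su tv.
have l2 := ip_cvg Lsc Ltc cu cv cs ct.
have l3 := ip_cvg Lss Lts ru rv ss st.
have l4 : fip (s_ n) (t_ n) @[n --> \oo] -->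
    fip (fun x => u x * \1_cell x) (fun x => v x * \1_cell x).
  by apply: cvgD; [exact: l2|exact: l3].
have l5 : kappa R * ip (leb2 R) (s_ n) (t_ n) @[n --> \oo] -->
    kappa R * ip (leb2 R) (fun x => u x * \1_cell x) (fun x => v x * \1_cell x).
  by apply: cvgM; [exact: cvg_cst|exact: l1].
apply: cvg_unique l5; first exact: Rhausdorff.
have -> : (fun n => kappa R * ip (leb2 R) (s_ n) (t_ n)) = (fun n => fip (s_ n) (t_ n)).
  by apply/funext => n; rewrite step_plancherel.
exact: l4.
Qed.

End plancherel_cell.

(** * The Fourier transform on L^2 *)

Section L2_norm.
Context (R : realType).
Implicit Types (u v a b f g : plane R -> R).

Lemma inL2P u : inL2 u -> L2 (leb2 R) u.
Proof.
move=> Lu; have Iu := Lfun2_integrable_sqr Lu.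
by split=> //; move: Lu; rewrite /inL2 inE => /andP[/[!inE]/= mf _].
Qed.

Lemma L2norm_sqr u : L2 (leb2 R) u ->
  ('N[leb2 R]_(2%:E)[EFin \o u] = (Num.sqrt (nsq (leb2 R) u))%:E)%E.
Proof.
move=> [mu Iu].
rewrite unlock /=.
under eq_integral => x _ do rewrite /= -[2]/(2%:R) powR_mulrn// -normrX ger0_norm ?sqr_ge0//.
rewrite int_fineK// -nsqE poweR_EFin; congr EFin.
by rewrite powR12_sqrt// nsq_ge0.
Qed.

Lemma L2normE u : L2 (leb2 R) u -> L2norm u ^+ 2 = nsq (leb2 R) u.
Proof. by move=> Lu; rewrite /L2norm L2norm_sqr//= sqr_sqrtr// nsq_ge0. Qed.

Lemma cvgL2P (f_ : nat -> plane R -> R) f :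
  (forall n, L2 (leb2 R) (f_ n)) -> L2 (leb2 R) f -> cvgL2 f_ f ->
  cvgL2sq (leb2 R) f_ f.
Proof.
move=> Lf_ Lf; rewrite /cvgL2 /cvgL2sq.
have -> : (fun n => 'N[leb2 R]_(2%:E)[EFin \o (f_ n \- f)%R])%E =
    (fun n => (Num.sqrt (nsq (leb2 R) (fun x => f_ n x - f x)))%:E).
  by apply/funext => n; rewrite -L2norm_sqr//; exact: L2B.
move=> /fine_cvg/= h.
rewrite (_ : (fun n => _) = fun n => Num.sqrt (nsq (leb2 R) (fun x => f_ n x - f x)) *
   Num.sqrt (nsq (leb2 R) (fun x => f_ n x - f x))); last first.
  by apply/funext => n; rewrite -expr2 sqr_sqrtr// nsq_ge0.
by rewrite -[X in _ --> X](mulr0 (0 : R)); apply: cvgM.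
Qed.

(** The closed squares of the definition of the transform and the half-open ones
    generated by rectangles differ by two sides. *)
Lemma box_cell_null (n : nat) : (leb2 R) (@box R n `\` cell n%:R) = 0%E.
Proof.
pose N1 : set (plane R) := [set - n%:R] `*` setT.
pose N2 : set (plane R) := setT `*` [set - n%:R].
have mN1 : measurable N1 by exact: measurableX.
have mN2 : measurable N2 by exact: measurableX.
have N10 : (leb2 R) N1 = 0%E.
  by rewrite product_measure1E// [X in (X * _)%E]lebesgue_measure_set1 mul0e.
have N20 : (leb2 R) N2 = 0%E.
  by rewrite product_measure1E// [X in (_ * X)%E]lebesgue_measure_set1 mule0.
have N0 : (leb2 R) (N1 `|` N2) = 0%E by apply: null_set_setU.
apply: (subset_measure0 (B := N1 `|` N2)) => //.
- by apply: measurableD; exact: measurableX.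
- exact: measurableU.
- move=> [x y] [[/=]]; rewrite !in_itv/= => /andP[x1 x2] /andP[y1 y2] h.
  have [->|nx] := eqVneq x (- n%:R); first by left.
  have [->|ny] := eqVneq y (- n%:R); first by right.
  exfalso; apply: h; split => /=; rewrite in_itv/= lt_neqAle eq_sym.
    by rewrite nx x1 x2.
  by rewrite ny y1 y2.
Qed.

Lemma int_box_cell (n : nat) f : L1 (leb2 R) (fun x => f x * \1_(@box R n) x) ->
  \int[leb2 R]_(x in @box R n) f x = \int[leb2 R]_x (f x * \1_(cell n%:R) x).
Proof.
move=> If; have mb : measurable (@box R n) by exact: measurableX.
have mc := measurable_cell (n%:R : R).
rewrite -int_indic; congr fine.
rewrite (@negligible_integral _ _ _ _ _ (@box R n `\` cell n%:R))//.
- rewrite setDD; congr integral; apply/seteqP; split=> [x []//|x cx]; split=> //.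
  case: cx => /=; rewrite !in_itv/= => /andP[h1 h2] /andP[h3 h4].
  by split; rewrite /= in_itv/=; apply/andP; split => //; exact: ltW.
- exact: measurableD.
- exact/L1_indicP.
- exact: box_cell_null.
Qed.

Definition trunc u (n : nat) : plane R -> R := fun x => u x * \1_(cell n%:R) x.

Lemma L2_trunc u n : L2 (leb2 R) u -> L2 (leb2 R) (trunc u n).
Proof. exact: L2_cell. Qed.

Lemma trunc_cvg u : L2 (leb2 R) u -> cvgL2sq (leb2 R) (trunc u) u.
Proof.
move=> Lu; have [mu _] := Lu.
apply: (cvgL2sq_dct (g := u)) => //.
- by move=> n; have [] := L2_trunc n Lu.
- move=> x; apply: cvg_near_cst.
  have [k hk] : exists k : nat, `|x.1| + `|x.2| < k%:R.
    exists (Num.bound (`|x.1| + `|x.2|)).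
    by apply: le_lt_trans (archi_boundP _) => //; rewrite ?addr_ge0.
  exists k => // n /= kn; rewrite /trunc indicE mem_set ?mulr1//.
  have hn : `|x.1| + `|x.2| < n%:R by rewrite (lt_le_trans hk)// ler_nat.
  have h1 : `|x.1| < n%:R by apply: le_lt_trans hn; rewrite lerDl.
  have h2 : `|x.2| < n%:R by apply: le_lt_trans hn; rewrite lerDr.
  move: h1 h2; rewrite !ltr_norml => /andP[a1 /ltW a2] /andP[b1 /ltW b2].
  by split; rewrite /= in_itv/= ?a1 ?b1.
- move=> n x; rewrite /trunc indicE; case: (_ \in _).
    by rewrite mulr1 subrr normr0.
  by rewrite mulr0 sub0r normrN.
Qed.

Lemma L1_box u (n : nat) : L2 (leb2 R) u -> L1 (leb2 R) (fun x => u x * \1_(@box R n) x).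
Proof.
move=> Lu; apply: L2M => //.
have Li : L2 lebesgue_measure (\1_(`[- n%:R, n%:R]%classic) : measurableTypeR R -> R).
  split=> //; rewrite (_ : (fun x => _) = \1_(`[- n%:R, n%:R]%classic)).
    exact: integrable_indic_itv.
  by apply/funext => x; rewrite indicE; case: (_ \in _); rewrite ?expr1n ?expr0n.
rewrite (_ : \1_(@box R n) = tens \1_(`[- n%:R, n%:R]%classic) \1_(`[- n%:R, n%:R]%classic)).
  exact: L2_tens.
by apply/funext => x; rewrite indic_setX.
Qed.

Lemma cos_truncE u n : L2 (leb2 R) u -> cos_trunc u n = cosT (trunc u n).
Proof.
move=> Lu; apply/funext => xi; rewrite /cos_trunc int_box_cell.
  by apply: eq_Rintegral => x _; rewrite mulrA.
under eq_fun do rewrite -mulrA; apply: L1_cos; exact: L1_box.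
Qed.

Lemma sin_truncE u n : L2 (leb2 R) u -> sin_trunc u n = sinT (trunc u n).
Proof.
move=> Lu; apply/funext => xi; rewrite /sin_trunc int_box_cell.
  by apply: eq_Rintegral => x _; rewrite mulrA.
under eq_fun do rewrite -mulrA; apply: L1_sin; exact: L1_box.
Qed.

(** The imaginary part of the transform with kernel [exp(- i x . xi)]. *)
Definition NsinT u : plane R -> R := fun xi => - sinT u xi.

Lemma L2N f : L2 (leb2 R) f -> L2 (leb2 R) (fun x => - f x).
Proof. by move=> Lf; under eq_fun do rewrite -mulN1r; exact: L2Z. Qed.

Lemma is_fourierP u a b : is_fourier u a b ->
  [/\ [/\ L2 (leb2 R) u, L2 (leb2 R) a & L2 (leb2 R) b],
      forall n, L2 (leb2 R) (cosT (trunc u n)),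
      forall n, L2 (leb2 R) (NsinT (trunc u n)),
      cvgL2sq (leb2 R) (fun n => cosT (trunc u n)) a &
      cvgL2sq (leb2 R) (fun n => NsinT (trunc u n)) b].
Proof.
move=> [/inL2P Lu /inL2P La /inL2P Lb ca cb].
have Lc n : L2 (leb2 R) (cosT (trunc u n)) by have [] := plancherel_cell n%:R Lu Lu.
have Ls n : L2 (leb2 R) (NsinT (trunc u n)).
  by apply: L2N; have [] := plancherel_cell n%:R Lu Lu.
split=> //; apply: cvgL2P => //.
- by under eq_fun do rewrite -cos_truncE//.
- rewrite (_ : (fun n => _) = fun n xi => - sin_trunc u n xi)//.
  by apply/funext => n; apply/funext => xi; rewrite /NsinT sin_truncE.
Qed.

Lemma plancherel_supp r u v : L2 (leb2 R) u -> L2 (leb2 R) v ->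
  (forall x, u x * \1_(cell r) x = u x) -> (forall x, v x * \1_(cell r) x = v x) ->
  ip (leb2 R) (cosT u) (cosT v) + ip (leb2 R) (NsinT u) (NsinT v) =
  kappa R * ip (leb2 R) u v.
Proof.
move=> Lu Lv Su Sv; have [_ _] := plancherel_cell r Lu Lv.
have -> : (fun x => u x * \1_(cell r) x) = u by exact/funext.
have -> : (fun x => v x * \1_(cell r) x) = v by exact/funext.
move=> <-; congr (_ + _); apply: eq_Rintegral => xi _.
by rewrite /NsinT mulrNN.
Qed.

Lemma indic_cell_le (r r' : R) (x : plane R) : r <= r' ->
  \1_(cell r) x * \1_(cell r') x = \1_(cell r) x :> R.
Proof.
move=> rr; rewrite !indicE; have [/set_mem[/= h1 h2]|] := boolP (x \in cell r); last by rewrite mul0r.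
rewrite mem_set ?mulr1//; move: h1 h2; rewrite /cell !in_itv/= => /andP[h1 h2] /andP[h3 h4].
by split; rewrite /= in_itv/=; apply/andP; split; lra.
Qed.

End L2_norm.

Section parseval.
Context (R : realType).
Implicit Types (u v a b f g h : plane R -> R) (c s : R).
Notation mu := (leb2 R).

Definition dil c (x : plane R) : plane R := (c * x.1, c * x.2).

Lemma measurable_dil c : measurable_fun setT (dil c).
Proof. by apply: measurable_fun_pair; apply: measurable_funM. Qed.

Section dil.
Variable c : R.
Hypothesis c0 : 0 < c.

Let k0 : 0 <= c^-1 ^+ 2. Proof. exact: sqr_ge0. Qed.

Let tE (F : plane R -> \bar R) : measurable_fun setT F -> (forall x, 0 <= F x)%E ->
  (\int[mu]_x F (dil c x) = (c^-1 ^+ 2)%:E * \int[mu]_x F x)%E.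
Proof.
by move=> mF F0; rewrite (@ge0_int_dilation2 R c) ?gt_eqF// gtr0_norm.
Qed.

Lemma L1_dil f : L1 mu f -> L1 mu (f \o dil c).
Proof. exact: (L1_comp (measurable_dil c) k0 tE). Qed.

Lemma int_dil f : L1 mu f -> \int[mu]_x f (dil c x) = c^-1 ^+ 2 * \int[mu]_x f x.
Proof. exact: (int_comp (measurable_dil c) k0 tE). Qed.

Lemma L2_dil f : L2 mu f -> L2 mu (f \o dil c).
Proof. exact: (L2_comp (measurable_dil c) k0 tE). Qed.

Lemma ip_dil f g : L2 mu f -> L2 mu g ->
  ip mu (f \o dil c) (g \o dil c) = c^-1 ^+ 2 * ip mu f g.
Proof. exact: (ip_comp (measurable_dil c) k0 tE). Qed.

Lemma cvgL2sq_dil (f_ : nat -> plane R -> R) f :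
  (forall n, L2 mu (f_ n)) -> L2 mu f -> cvgL2sq mu f_ f ->
  cvgL2sq mu (fun n => f_ n \o dil c) (f \o dil c).
Proof.
move=> Lf_ Lf h; rewrite /cvgL2sq.
have -> : (fun n => nsq mu (fun x => (f_ n \o dil c) x - (f \o dil c) x)) =
    (fun n => c^-1 ^+ 2 * nsq mu (fun x => f_ n x - f x)).
  by apply/funext => n; rewrite -ip_dil//; exact: L2B.
by rewrite -[X in _ --> X](mulr0 (c^-1 ^+ 2)); apply: cvgM; [exact: cvg_cst|exact: h].
Qed.

Lemma dilK x : dil c (dil c^-1 x) = x.
Proof. by case: x => x y; rewrite /dil/= !mulVKf ?gt_eqF. Qed.

Lemma dotp_dil x xi : dotp (dil c x) (dil c^-1 xi) = dotp x xi.
Proof. by rewrite /dotp /dil/=; field; rewrite gt_eqF. Qed.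

Lemma cosT_dil f xi : L1 mu f ->
  cosT (f \o dil c) xi = c^-1 ^+ 2 * cosT f (dil c^-1 xi).
Proof.
move=> If; rewrite /cosT -int_dil; last exact: L1_cos.
by apply: eq_Rintegral => x _; rewrite /= dotp_dil.
Qed.

Lemma NsinT_dil f xi : L1 mu f ->
  NsinT (f \o dil c) xi = c^-1 ^+ 2 * NsinT f (dil c^-1 xi).
Proof.
move=> If; rewrite /NsinT mulrN; congr (- _).
rewrite /sinT -int_dil; last exact: L1_sin.
by apply: eq_Rintegral => x _; rewrite /= dotp_dil.
Qed.

Lemma cell_dil r x : \1_(cell r) (dil c x) = \1_(cell (r / c)) x :> R.
Proof.
have E y : \1_(`]- r, r]%classic) (c * y) = \1_(`](- (r / c)), (r / c)]%classic) y :> R.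
  rewrite !indicE; congr (nat_of_bool _)%:R; apply/idP/idP; rewrite !inE/= !in_itv/=;
  by rewrite ler_pdivlMr// -mulNr ltr_pdivrMr// mulrC.
by rewrite !indic_setX /= !E.
Qed.

End dil.

Lemma dil1 x : dil 1 x = x.
Proof. by case: x => x y; rewrite /dil/= !mul1r. Qed.

(** Parseval's identity for [u] and a dilate of [v]; the truncations of the two
    functions are compared in one common cell. *)
Lemma parseval_dil c u v a b a' b' : 0 < c ->
  is_fourier u a b -> is_fourier v a' b' ->
  c^-1 ^+ 2 * (ip mu a (a' \o dil c^-1) + ip mu b (b' \o dil c^-1)) =
  kappa R * ip mu u (v \o dil c).
Proof.
move=> c0 /is_fourierP[[Lu La Lb] Lcu Lsu cua sub].
move=> /is_fourierP[[Lv La' Lb'] Lcv Lsv cva svb].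
have ci0 : 0 < c^-1 by rewrite invr_gt0.
have Lun n := L2_trunc n Lu; have Lvn n := L2_trunc n Lv.
have E n : c^-1 ^+ 2 * (ip mu (cosT (trunc u n)) (cosT (trunc v n) \o dil c^-1)
     + ip mu (NsinT (trunc u n)) (NsinT (trunc v n) \o dil c^-1)) =
     kappa R * ip mu (trunc u n) (trunc v n \o dil c).
  (* The dilate of a function supported in the cell of size [n] is supported in
     that of size [n / c]. *)
  pose r : R := Num.max n%:R (n%:R / c).
  have Sv : forall x, trunc v n x * \1_(cell n%:R) x = trunc v n x.
    by move=> x; rewrite /trunc -mulrA indic_cell_le.
  have [Iv _] := cell_L1 (Lvn n) Sv.
  rewrite -(@plancherel_supp _ r)//.
  - rewrite (_ : cosT (trunc v n \o dil c) =
      fun xi => c^-1 ^+ 2 * (cosT (trunc v n) \o dil c^-1) xi); last first.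
      by apply/funext => xi; rewrite cosT_dil.
    rewrite (_ : NsinT (trunc v n \o dil c) =
      fun xi => c^-1 ^+ 2 * (NsinT (trunc v n) \o dil c^-1) xi); last first.
      by apply/funext => xi; rewrite NsinT_dil.
    have L3 := L2_dil ci0 (Lcv n); have L4 := L2_dil ci0 (Lsv n).
    rewrite (ipC _ _ (fun xi => _ * _)) (ipZl _ L3 (Lcu n)).
    rewrite (ipC _ _ (fun xi => _ * _)) (ipZl _ L4 (Lsu n)).
    by rewrite mulrDr (ipC _ (cosT (trunc u n))) (ipC _ (NsinT (trunc u n))).
  - exact: L2_dil.
  - by move=> x; rewrite /trunc -mulrA indic_cell_le// le_max lexx.
  - move=> x; rewrite /= /trunc -mulrA cell_dil// indic_cell_le//.
    by rewrite le_max lexx orbT.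
have l1 : kappa R * ip mu (trunc u n) (trunc v n \o dil c) @[n --> \oo] -->
    kappa R * ip mu u (v \o dil c).
  apply: cvgM; first exact: cvg_cst.
  apply: (ip_cvg Lun _ Lu (L2_dil c0 Lv) (trunc_cvg Lu) (cvgL2sq_dil c0 Lvn Lv (trunc_cvg Lv))).
  by move=> n; exact: L2_dil.
have l2 : c^-1 ^+ 2 * (ip mu (cosT (trunc u n)) (cosT (trunc v n) \o dil c^-1)
     + ip mu (NsinT (trunc u n)) (NsinT (trunc v n) \o dil c^-1)) @[n --> \oo] -->
   c^-1 ^+ 2 * (ip mu a (a' \o dil c^-1) + ip mu b (b' \o dil c^-1)).
  apply: cvgM; first exact: cvg_cst.
  apply: cvgD.
    apply: (ip_cvg Lcu _ La (L2_dil ci0 La') cua (cvgL2sq_dil ci0 Lcv La' cva)).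
    by move=> n; exact: L2_dil.
  apply: (ip_cvg Lsu _ Lb (L2_dil ci0 Lb') sub (cvgL2sq_dil ci0 Lsv Lb' svb)).
  by move=> n; exact: L2_dil.
rewrite (funext E) in l2.
by apply: (cvg_unique _ l2 l1); exact: Rhausdorff.
Qed.

Lemma parseval u v a b a' b' : is_fourier u a b -> is_fourier v a' b' ->
  ip mu a a' + ip mu b b' = kappa R * ip mu u v.
Proof.
move=> hu hv; have := parseval_dil ltr01 hu hv.
have E f : f \o dil 1 = f by apply/funext => x; rewrite /= dil1.
by rewrite invr1 !E expr1n mul1r.
Qed.

Lemma fraclap_symbol_dil s c (xi : plane R) : 0 < c ->
  fraclap_symbol s (dil c xi) = c `^ (2 * s) * fraclap_symbol s xi.
Proof.
move=> c0; rewrite /fraclap_symbol /dil/= !exprMn -mulrDr sqrtrM ?sqr_ge0//.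
by rewrite sqrtr_sqr gtr0_norm// powRM ?sqrtr_ge0// ltW.
Qed.

Lemma fraclap_symbol_half s (xi : plane R) : 0 < s ->
  fraclap_symbol (s / 2) xi ^+ 2 = fraclap_symbol s xi.
Proof.
move=> s0; rewrite /fraclap_symbol.
have [->|r0] := eqVneq (Num.sqrt (xi.1 ^+ 2 + xi.2 ^+ 2)) 0.
  by rewrite !powR0 ?expr0n// mulf_neq0// ?gt_eqF// divr_gt0.
by rewrite expr2 -powRD ?r0 ?implybT//; congr (_ `^ _); field.
Qed.

(** Limits in L^2 are unique. The domains of [(-Delta)^s] and [(-Delta)^(s/2)]
    come with transforms of the same function that may differ on a null set. *)
Lemma fourier_nsq_eq0 u a b a' b' : is_fourier u a b -> is_fourier u a' b' ->
  nsq mu (fun x => a x - a' x) = 0 /\ nsq mu (fun x => b x - b' x) = 0.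
Proof.
have key (f_ : nat -> plane R -> R) f g : (forall n, L2 mu (f_ n)) -> L2 mu f -> L2 mu g ->
    cvgL2sq mu f_ f -> cvgL2sq mu f_ g -> nsq mu (fun x => f x - g x) = 0.
  move=> Lf_ Lf Lg hf hg.
  have h n : nsq mu (fun x => f x - g x) <=
      2 * nsq mu (fun x => f_ n x - g x) + 2 * nsq mu (fun x => f_ n x - f x).
    apply: le_trans (nsqB_le (L2B (Lf_ n) Lg) (L2B (Lf_ n) Lf)).
    rewrite le_eqVlt; apply/orP; left; apply/eqP; congr (nsq _ _).
    by apply/funext => x; ring.
  apply/eqP; rewrite eq_le nsq_ge0 andbT.
  have l : 2 * nsq mu (fun x => f_ n x - g x) + 2 * nsq mu (fun x => f_ n x - f x)
      @[n --> \oo] --> (2 * 0 + 2 * 0 : R).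
    by apply: cvgD; apply: cvgM; (exact: cvg_cst || exact: hf || exact: hg).
  rewrite mulr0 addr0 in l.
  by apply: (cvgr_to_ge l); exact: nearW.
move=> /is_fourierP[[Lu La Lb] Lc Ls ca sb] /is_fourierP[[_ La' Lb'] _ _ ca' sb'].
by split; [exact: (key _ _ _ Lc La La' ca ca')|exact: (key _ _ _ Ls Lb Lb' sb sb')].
Qed.

Lemma nsq_eq0_ae f : L2 mu f -> nsq mu f = 0 -> {ae mu, forall x, f x = 0}.
Proof.
move=> [mf If] f0.
have : (\int[mu]_x `|(f x ^+ 2)%:E| = 0)%E.
  under eq_integral => x _ do rewrite /= ger0_norm ?sqr_ge0//.
  by rewrite int_fineK// -nsqE f0.
move/(ae_eq_integral_abs mu measurableT).
move=> H; have {H} := H _; rewrite measurable_EFinP => H.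
have {H} := H (measurable_funX 2 mf).
by apply: filterS => x /(_ I)/= [] /eqP; rewrite sqrf_eq0 => /eqP.
Qed.

Lemma int_ae f g : measurable_fun setT f -> measurable_fun setT g ->
  {ae mu, forall x, f x = g x} -> \int[mu]_x f x = \int[mu]_x g x.
Proof.
move=> mf mg fg; congr fine; apply: ae_eq_integral => //;
  [exact/measurable_EFinP|exact/measurable_EFinP|].
by apply: filterS fg => x -> _.
Qed.

Lemma measurable_fraclap_symbol s : measurable_fun setT (@fraclap_symbol R s).
Proof.
apply: (measurableT_comp (f := fun t : R => t `^ (2 * s))); first exact: measurable_powR.
apply: (measurableT_comp (f := @Num.sqrt R)).
  exact: (continuous_measurable_fun (@sqrt_continuous R)).
by apply: measurable_funD; apply: measurable_funX.
Qed.

(** On the transform side, [(-Delta)^(s/2)] multiplies by the square root of the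
    symbol of [(-Delta)^s]. *)
Lemma fraclap_energy s u g h : 0 < s -> is_fraclap s u g -> is_fraclap (s / 2) u h ->
  ip mu g u = nsq mu h.
Proof.
move=> s0 [a [b [ha hg]]] [a' [b' [ha' hh]]].
have k0 : kappa R != 0 by rewrite gt_eqF// kappa_gt0.
apply: (mulfI k0); rewrite -(parseval hg ha) -(parseval hh hh).
have [ea eb] := fourier_nsq_eq0 ha ha'.
have [[_ La Lb] _ _ _ _] := is_fourierP ha.
have [[_ La' Lb'] _ _ _ _] := is_fourierP ha'.
have [[_ Lsa Lsb] _ _ _ _] := is_fourierP hg.
have [[_ Lsa' Lsb'] _ _ _ _] := is_fourierP hh.
have key f f' : L2 mu f -> L2 mu f' -> nsq mu (fun x => f x - f' x) = 0 ->
    ip mu (fun xi => fraclap_symbol s xi * f xi) f =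
    ip mu (fun xi => fraclap_symbol (s / 2) xi * f' xi)
          (fun xi => fraclap_symbol (s / 2) xi * f' xi).
  move=> Lf Lf' ff'; have [mf _] := Lf; have [mf' _] := Lf'.
  have ms := measurable_fraclap_symbol s; have ms2 := measurable_fraclap_symbol (s / 2).
  apply: int_ae.
  - by apply: measurable_funM => //; exact: measurable_funM.
  - by apply: measurable_funM; exact: measurable_funM.
  - apply: filterS (nsq_eq0_ae (L2B Lf Lf') ff') => xi /subr0_eq ->.
    by rewrite -(fraclap_symbol_half _ s0); ring.
by rewrite (key a a')// (key b b').
Qed.

(** Homogeneity: conjugating [(-Delta)^s] with a dilation multiplies it by a
    power of the ratio, and by the symmetry of the multiplier a dilation of one
    argument can be moved to the other. *)
Lemma fraclap_dil s u g c : 0 < c -> is_fraclap s u g ->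
  ip mu g (u \o dil c^-1) = c ^+ 2 * c^-1 `^ (2 * s) * ip mu g (u \o dil c).
Proof.
move=> c0 [a [b [ha hg]]]; have ci0 : 0 < c^-1 by rewrite invr_gt0.
have k0 : kappa R != 0 by rewrite gt_eqF// kappa_gt0.
apply: (mulfI k0); rewrite mulrCA -(parseval_dil c0 hg ha) -(parseval_dil ci0 hg ha).
have [[_ La Lb] _ _ _ _] := is_fourierP ha.
have [[_ Lsa Lsb] _ _ _ _] := is_fourierP hg.
have key f : L2 mu f -> L2 mu (fun xi => fraclap_symbol s xi * f xi) ->
    ip mu (fun xi => fraclap_symbol s xi * f xi) (f \o dil c^-1) * c^-1 `^ (2 * s) =
    c ^+ 2 * ip mu (fun xi => fraclap_symbol s xi * f xi) (f \o dil c).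
  move=> Lf Lsf; have L := L2M Lsf (L2_dil c0 Lf).
  rewrite -[in c ^+ 2](invrK c) -int_dil//= mulrC /ip -intZ; last exact: L2M Lsf (L2_dil ci0 Lf).
  apply: eq_Rintegral => xi _ /=; rewrite fraclap_symbol_dil// dilK//; ring.
have c0' : c != 0 by rewrite gt_eqF.
rewrite invrK mulrDr -(key a)// -(key b)//.
rewrite -mulrDl; move: (_ + _) (c^-1 `^ _) => X P; by field.
Qed.

End parseval.

(** * Radial derivatives *)

(** Fubini's theorem for a measure that the maps [tau t] multiply by a power of
    [t], the case in point being the dilations of the plane. *)
Section scaling_fubini.
Context d (T : measurableType d) (R : realType).
Variables (m : {sigma_finite_measure set T -> \bar R}) (tau : R -> T -> T).
Notation leb := (@lebesgue_measure R).
Hypothesis mtau :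
  measurable_fun setT (fun p : T * measurableTypeR R => tau p.2 p.1).
Hypothesis L1_tau : forall t (K : T -> R), 0 < t -> L1 m K -> L1 m (K \o tau t).
Hypothesis int_tau : forall t (K : T -> R), 0 < t -> L1 m K ->
  \int[m]_x K (tau t x) = t^-1 ^+ 2 * \int[m]_x K x.

(** The parameter [t] ranges over an interval away from 0; the indicator is kept
    in the integrand, where it also covers the [t] for which [tau t] need not
    preserve integrability. *)
Lemma int_scaling_tonelli a b (w : measurableTypeR R -> R) (K : T -> R) : 0 < a ->
  measurable_fun setT w -> L1 m K ->
  L1 leb (fun t => \1_(`]a, b]%classic) t * (w t * t^-1 ^+ 2)) ->
  [/\ L1 (m \x leb)%E (fun p => \1_(`]a, b]%classic) p.2 * (w p.2 * K (tau p.2 p.1))) &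
   \int[(m \x leb)%E]_p (\1_(`]a, b]%classic) p.2 * (w p.2 * K (tau p.2 p.1)))
    = \int[leb]_t (\1_(`]a, b]%classic) t * (w t * t^-1 ^+ 2)) * \int[m]_x K x].
Proof.
move=> a0 mw IK Iw.
pose F (p : T * measurableTypeR R) : R :=
  \1_(`]a, b]%classic) p.2 * (w p.2 * K (tau p.2 p.1)).
have mF : measurable_fun setT F.
  have mi : measurable_fun setT (\1_(`]a, b]%classic) : measurableTypeR R -> R) by [].
  apply: measurable_funM; first exact: (measurableT_comp mi measurable_snd).
  apply: measurable_funM; first exact: (measurableT_comp mw measurable_snd).
  exact: (measurableT_comp (L1_measurable IK) mtau).
have pos t : \1_(`]a, b]%classic) t != 0 :> R -> 0 < t.
  rewrite indicE; have [/set_mem/=|] := boolP (t \in _); last by rewrite eqxx.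
  by rewrite in_itv/= => /andP[at_ _] _; exact: lt_trans at_.
have slice c t (k : T -> R) : (c != 0 -> 0 < t) -> L1 m k ->
    L1 m (fun x => c * k (tau t x)) /\
    \int[m]_x (c * k (tau t x)) = c * t^-1 ^+ 2 * \int[m]_x k x.
  move=> ct Ik; have [->|c0] := eqVneq c 0.
    have -> : (fun x => 0 * k (tau t x)) = (fun=> 0) :> (T -> R).
      by apply/funext => x; rewrite mul0r.
    by rewrite !mul0r /Rintegral integral0; split => //; exact: integrable0.
  have Ikt := L1_tau (ct c0) Ik.
  by split; [exact: L1Z|rewrite (intZ _ Ikt) int_tau ?ct// mulrA].
have posM t : \1_(`]a, b]%classic) t * w t != 0 :> R -> 0 < t.
  by rewrite mulf_eq0 negb_or => /andP[/pos].
have IF : L1 (m \x leb)%E F.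
  apply/integrable21ltyP; first exact/measurable_EFinP.
  have Es t : (\int[m]_x `|(F (x, t))%:E| = (\int[m]_x `|K x| *
      `|\1_(`]a, b]%classic) t * (w t * t^-1 ^+ 2)|)%:E)%E.
    have [|I1 I2] := slice `|\1_(`]a, b]%classic) t * w t| t _ _ (L1_norm IK).
      by rewrite normr_eq0; exact: posM.
    transitivity (\int[m]_x (`|\1_(`]a, b]%classic) t * w t| * `|K (tau t x)|)%:E)%E.
      by apply: eq_integral => x _; rewrite /= /F/= -normrM mulrA.
    rewrite (int_fineK I1) I2; congr EFin.
    rewrite mulrC; congr (_ * _).
    by rewrite (mulrA (\1_ _ t)) [RHS]normrM (ger0_norm (sqr_ge0 t^-1)).
  under eq_integral do rewrite Es.
  by rewrite int_fineK ?ltry//; exact/L1Z/L1_norm.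
split=> //.
rewrite /Rintegral -integral21_prod_meas1//.
transitivity (\int[leb]_t (\int[m]_x K x * (\1_(`]a, b]%classic) t * (w t * t^-1 ^+ 2)))).
  congr fine; apply: eq_integral => t _.
  have [I1 I2] := slice (\1_(`]a, b]%classic) t * w t) t _ (posM t) IK.
  rewrite mulrC mulrA -I2 -int_fineK//.
  by apply: eq_integral => x _; rewrite /= mulrA.
by rewrite intZ// mulrC.
Qed.

(** [E] is the derivative of [psi] along the flow, the radial derivative
    [x . grad psi] in the case of dilations. The derivative [e x] of
    [t |-> psi (tau t x)] is [E (tau t x) / t]; stated as a product, the relation
    makes sense at [t = 0]. *)
Definition radial_derive (psi E : T -> R) : Prop := exists e : T -> R -> R,
  [/\ forall x (t : R), is_derive t 1 (fun t => psi (tau t x)) (e x t),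
      forall x, continuous (e x) &
      forall x t, t * e x t = E (tau t x)].

(** Integration by parts without boundary terms. The derivative of
    [t^2 psi(t x)] is [t K(t x)] with [K = E + 2 psi]. Integrated over
    [1 < t < 2] and then over [x], it gives [4 psi(2 x) - psi(x)], whose integral
    vanishes because a dilation by [t] divides the integral by [t^2]; integrated
    in the other order, it gives a positive multiple of the integral of [K]. *)
Lemma radial_int (psi E : T -> R) : L1 m psi -> L1 m E -> radial_derive psi E ->
  \int[m]_x E x = - 2 * \int[m]_x psi x.
Proof.
move=> Ipsi IE [e [de ce eE]].
pose K x := E x + 2 * psi x.
have IK : L1 m K by apply: L1D => //; exact: L1Z.
pose W t : R := \1_(`]1, 2]%classic) t * (t * t^-1 ^+ 2).
have mw : measurable_fun setT (id : measurableTypeR R -> R) by exact: measurable_id.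
have mW : measurable_fun setT (W : measurableTypeR R -> R).
  apply: measurable_funM => //; apply: measurable_funM => //.
  by apply: measurable_funX; exact: measurable_invr.
have I1 : L1 leb \1_(`]1, 2]%classic) by exact: integrable_indic_itv.
have W12 t : 2^-1 * \1_(`]1, 2]%classic) t <= W t <= \1_(`]1, 2]%classic) t.
  rewrite /W indicE; have [/set_mem/=|_] := boolP (t \in _); last by rewrite mul0r mulr0 lexx.
  rewrite in_itv/= => /andP[t1 t2]; rewrite mul1r mulr1.
  have t0 : 0 < t by apply: lt_trans t1.
  rewrite exprVn expr2 invfM mulVKf ?gt_eqF//.
  by rewrite lef_pV2 ?posrE// t2 invf_le1// ltW.
have IW : L1 leb W.
  apply: (L1_le mW _ I1) => t; have /andP[h1 h2] := W12 t.
  by rewrite ger0_norm// (le_trans _ h1)// mulr_ge0.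
have W0 : 0 < \int[leb]_t W t.
  apply: (@lt_le_trans _ _ (\int[leb]_t (2^-1 * \1_(`]1, 2]%classic) t))).
    rewrite intZ// mulr_gt0// /Rintegral integral_indic//= setIT lebesgue_measure_itv/=.
    by rewrite lte_fin ltr1n/=; lra.
  by apply: le_int => //; [exact: L1Z|move=> t; have /andP[] := W12 t].
have [IF EF] := int_scaling_tonelli (a := 1) (b := 2) ltr01 mw IK IW.
have E0 : \int[(m \x leb)%E]_p
    (\1_(`]1, 2]%classic) p.2 * (p.2 * K (tau p.2 p.1))) = 0.
  rewrite /Rintegral -integral12_prod_meas1//.
  have inner x : (\int[leb]_t (\1_(`]1, 2]%classic) t * (t * K (tau t x)))%:E =
      (4 * psi (tau 2 x) - psi (tau 1 x))%:E)%E.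
    have cpsi : continuous (fun t => psi (tau t x)).
      by move=> t; apply/differentiable_continuous/derivable1_diffP; case: (de x t).
    have [|t|t|Ii Ei] := @int_itv_derive R (fun t => t * (t * e x t + 2 * psi (tau t x)))
      (fun t => t ^+ 2 * psi (tau t x)) 1 2.
    - by rewrite ler1n.
    - apply: cvgM; first exact: cvg_id.
      apply: cvgD; first by apply: cvgM; [exact: cvg_id|exact: ce].
      by apply: cvgM; [exact: cvg_cst|exact: cpsi].
    - have := de x t => dpsi; apply: is_derive_eq.
      by rewrite /GRing.scale/=; ring.
    have Ek t : \1_(`]1, 2]%classic) t * (t * K (tau t x)) =
        t * (t * e x t + 2 * psi (tau t x)) * \1_(`]1, 2]%classic) t.
      by rewrite /K eE mulrC.
    under eq_integral do rewrite Ek.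
    rewrite int_fineK// Ei; congr EFin; ring.
  transitivity (\int[m]_x (4 * psi (tau 2 x) - psi (tau 1 x))).
    by congr fine; apply: eq_integral => x _; exact: inner.
  have I2 := L1_tau (t := 2) (ltr0n _ 2) Ipsi; have I1' := L1_tau ltr01 Ipsi.
  rewrite (intB (L1Z 4 I2) I1') (intZ 4 I2) !int_tau//.
  rewrite invr1; by field.
move: EF; rewrite E0 => /esym/eqP; rewrite mulf_eq0 gt_eqF//= => /eqP.
by rewrite (intD IE (L1Z 2 Ipsi)) intZ// => h; lra.
Qed.

(** The difference is the integral over [t] of the derivative [E(t x) / t].
    By Cauchy-Schwarz its square is at most [b - a] times the integral of
    [t^-2 E(t x)^2], and the integral over [x] of the latter is [t^-4] times the
    squared norm of [E]. *)
Lemma radial_L2 (psi E : T -> R) a b : L2 m psi -> L2 m E -> radial_derive psi E ->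
  0 < a -> a <= b ->
  nsq m (fun x => psi (tau b x) - psi (tau a x)) <=
    (b - a) ^+ 2 * a^-1 ^+ 4 * nsq m E.
Proof.
move=> Lpsi [mE IE] [e [de ce eE]] a0 ab.
pose K x := E x ^+ 2.
pose w (t : measurableTypeR R) : R := t^-1 ^+ 2.
pose W t : R := \1_(`]a, b]%classic) t * (w t * t^-1 ^+ 2).
have mw : measurable_fun setT w by apply: measurable_funX; exact: measurable_invr.
have mW : measurable_fun setT (W : measurableTypeR R -> R).
  by apply: measurable_funM => //; exact: measurable_funM.
have I1 : L1 leb \1_(`]a, b]%classic) by exact: integrable_indic_itv.
have i1 : \int[leb]_t \1_(`]a, b]%classic) t = b - a.
  rewrite /Rintegral integral_indic//= setIT lebesgue_measure_itv/= lte_fin.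
  by case: ltP => //= ba; apply/esym/eqP; rewrite subr_eq0 eq_le ba ab.
have Wle t : 0 <= W t <= a^-1 ^+ 4 * \1_(`]a, b]%classic) t.
  rewrite /W indicE; have [/set_mem/=|_] := boolP (t \in _); last by rewrite mul0r mulr0 lexx.
  rewrite in_itv/= => /andP[t1 t2]; rewrite mul1r mulr1 /w -exprD.
  have t0 : 0 < t by apply: lt_trans t1.
  by rewrite exprn_ge0 ?invr_ge0 ?(ltW t0)//= lerXn2r ?nnegrE ?invr_ge0 ?(ltW t0) ?(ltW a0)// lef_pV2 ?posrE// ltW.
have IW : L1 leb W.
  apply: (L1_le mW _ (L1Z (a^-1 ^+ 4) I1)) => t; have /andP[h1 h2] := Wle t.
  by rewrite ger0_norm.
have [IF EF] := int_scaling_tonelli a0 mw IE IW.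
pose J x : R := \int[leb]_t (\1_(`]a, b]%classic) t * (w t * K (tau t x))).
have ex t x : \1_(`]a, b]%classic) t * (w t * K (tau t x)) =
    e x t ^+ 2 * \1_(`]a, b]%classic) t.
  rewrite indicE; have [/set_mem/=|_] := boolP (t \in _); last by rewrite mul0r mulr0.
  rewrite in_itv/= => /andP[t1 t2]; rewrite mul1r mulr1 /w /K -eE.
  by have t0 : 0 < t by [apply: lt_trans t1]; field; rewrite gt_eqF.
have ce2 x : continuous (fun t => e x t ^+ 2).
  by move=> t; apply: (@continuous_comp _ _ _ (e x) (fun y => y ^+ 2)); [exact: ce|exact: exprn_continuous].
have IJt x : L1 leb (fun t => \1_(`]a, b]%classic) t * (w t * K (tau t x))).
  by under eq_fun do rewrite ex; exact: L1_itv_continuous.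
have JE : EFin \o J = fubini_F leb (fun p => (\1_(`]a, b]%classic) p.2 * (w p.2 * K (tau p.2 p.1)))%:E).
  by apply/funext => x; rewrite /= /J -int_fineK.
have IJ : L1 m J by rewrite /L1 JE; exact: integrable_fubini_F IF.
have intJ : \int[m]_x J x = \int[leb]_t W t * nsq m E.
  rewrite nsqE -EF /Rintegral -integral12_prod_meas1//.
  by congr fine; rewrite -JE.
have pt x : (psi (tau b x) - psi (tau a x)) ^+ 2 <= (b - a) * J x.
  have [Ie <-] := int_itv_derive ab (ce x) (de x).
  have Le : L2 leb (fun t => e x t * \1_(`]a, b]%classic) t).
    split; first exact: L1_measurable Ie.
    rewrite (_ : (fun t => _) = fun t => e x t ^+ 2 * \1_(`]a, b]%classic) t).
      exact: L1_itv_continuous.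
    apply/funext => t; rewrite exprMn indicE.
    by case: (_ \in _); rewrite ?expr1n ?expr0n.
  have := cauchy_schwarz Le (L2_itv a b).
  have -> : ip leb (fun t => e x t * \1_(`]a, b]%classic) t) \1_(`]a, b]%classic)
      = \int[leb]_t (e x t * \1_(`]a, b]%classic) t).
    apply: eq_Rintegral => t _; rewrite -mulrA indicE.
    by case: (_ \in _); rewrite ?mulr1 ?mulr0.
  have -> : nsq leb \1_(`]a, b]%classic) = b - a.
    rewrite -i1; apply: eq_Rintegral => t _; rewrite indicE.
    by case: (_ \in _); rewrite ?mulr1 ?mulr0.
  have -> : nsq leb (fun t => e x t * \1_(`]a, b]%classic) t) = J x.
    rewrite nsqE; apply: eq_Rintegral => t _; rewrite ex exprMn indicE.
    by case: (_ \in _); rewrite ?expr1n ?expr0n.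
  by rewrite mulrC.
have L2t t : 0 < t -> L2 m (psi \o tau t).
  move=> t0; have [mpsi Ipsi] := Lpsi; split; last exact: L1_tau t0 Ipsi.
  apply: (measurableT_comp mpsi).
  have mt : measurable_fun setT (fun x : T => (x, t) : T * measurableTypeR R).
    by apply: measurable_fun_pair.
  exact: (measurableT_comp mtau mt).
have [mq Iq] := L2B (L2t b (lt_le_trans a0 ab)) (L2t a a0).
rewrite nsqE; apply: (le_trans (le_int Iq (L1Z (b - a) IJ) pt)).
rewrite (intZ _ IJ) intJ mulrA ler_wpM2r ?nsq_ge0//.
rewrite expr2 -mulrA ler_wpM2l ?subr_ge0// mulrC -i1 -(intZ _ I1).
by apply: le_int => //; [exact: L1Z|move=> t; have /andP[] := Wle t].
Qed.

End scaling_fubini.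

Lemma measurable_dil2 (R : realType) :
  measurable_fun setT (fun p : plane R * measurableTypeR R => dil p.2 p.1).
Proof.
apply: measurable_fun_pair; apply: measurable_funM; try exact: measurable_snd.
  exact: (measurableT_comp measurable_fst measurable_fst).
exact: (measurableT_comp measurable_snd measurable_fst).
Qed.

(** * Continuously differentiable functions of the plane *)

Section C1_plane.
Context (R : realType).
Implicit Types (phi : plane R -> R) (x : plane R) (t : R).

Lemma is_derive_cvg (f : R -> R) t (l : R) :
  h^-1 * (f (h + t) - f t) @[h --> 0^'] --> l -> is_derive t 1 f l.
Proof.
move=> H.
have E : (fun h => h^-1 *: ((f \o shift t) (h *: 1) - f t)) =
    (fun h => h^-1 * (f (h + t) - f t)).
  by apply/funext => h; rewrite /= /GRing.scale/= mulr1.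
apply: DeriveDef; first by rewrite /derivable E; apply/cvg_ex; exists l.
by rewrite /derive E; apply/cvg_lim.
Qed.

Lemma is_derive_cvgP (f : R -> R) t (l : R) : is_derive t 1 f l ->
  h^-1 * (f (h + t) - f t) @[h --> 0^'] --> l.
Proof.
move=> [df <-].
have E : (fun h => h^-1 *: ((f \o shift t) (h *: 1) - f t)) =
    (fun h => h^-1 * (f (h + t) - f t)).
  by apply/funext => h; rewrite /= /GRing.scale/= mulr1.
by move: (df); rewrite /derivable /derive E.
Qed.

Lemma is_derive_dx phi x : derivable phi x (1, 0) ->
  is_derive x.1 1 (fun t => phi (t, x.2)) (dx phi x).
Proof.
move=> d; apply: is_derive_cvg.
have E : (fun h => h^-1 *: ((phi \o shift x) (h *: ((1, 0) : plane R)) - phi x)) =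
    (fun h => h^-1 * (phi (h + x.1, x.2) - phi (x.1, x.2))).
  apply/funext => h; case: x {d} => x y /=; congr (_ * (phi (_, _) - _)).
    exact: (congr1 (+%R^~ x) (mulr1 h)).
  exact: (etrans (congr1 (+%R^~ y) (mulr0 h)) (add0r y)).
by move: d; rewrite /derivable /dx /derive E.
Qed.

Lemma is_derive_dy phi x : derivable phi x (0, 1) ->
  is_derive x.2 1 (fun t => phi (x.1, t)) (dy phi x).
Proof.
move=> d; apply: is_derive_cvg.
have E : (fun h => h^-1 *: ((phi \o shift x) (h *: ((0, 1) : plane R)) - phi x)) =
    (fun h => h^-1 * (phi (x.1, h + x.2) - phi (x.1, x.2))).
  apply/funext => h; case: x {d} => x y /=; congr (_ * (phi (_, _) - _)).
    exact: (etrans (congr1 (+%R^~ x) (mulr0 h)) (add0r x)).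
  exact: (congr1 (+%R^~ y) (mulr1 h)).
by move: d; rewrite /derivable /dy /derive E.
Qed.

Lemma is_derive_scale (f : R -> R) (a t l : R) : is_derive (t * a) 1 f l ->
  is_derive t 1 (fun s => f (s * a)) (a * l).
Proof.
move=> d; have dg : is_derive t 1 (fun s : R => s * a) a.
  by apply: is_derive_eq; rewrite /GRing.scale/= mulr0 add0r mulr1.
by rewrite mulrC; exact: (@is_derive1_comp R f (fun s => s * a) t l a d dg).
Qed.

Lemma continuous_scale_pair x : continuous (fun p : R * R => (p.1 * x.1, p.2 * x.2) : plane R).
Proof.
have c1 : continuous (fun p : R * R => p.1) by move=> p; exact: cvg_fst.
have c2 : continuous (fun p : R * R => p.2) by move=> p; exact: cvg_snd.
move=> p; exact: (@cvg_pair _ _ _ (nbhs p) (nbhs (p.1 * x.1)) (nbhs (p.2 * x.2))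
  _ _ _ _ _ (cvgM (c1 p) (cvg_cst x.1)) (cvgM (c2 p) (cvg_cst x.2))).
Qed.

Lemma continuous_dil x : continuous (fun t : R => dil t x).
Proof.
have c : continuous (fun t : R => t) by move=> t; exact: cvg_id.
move=> t; exact: (@cvg_pair _ _ _ (nbhs t) (nbhs (t * x.1)) (nbhs (t * x.2))
  _ _ _ _ _ (cvgM (c t) (cvg_cst x.1)) (cvgM (c t) (cvg_cst x.2))).
Qed.

(** The chain rule for [t |-> phi (t x)]. The increment is split into one step
    in each variable. The second is differentiated at [t] itself; the first
    starts from a moving point, and the mean value theorem expresses it by [dx]
    at an intermediate point, which converges by continuity of [dx]. *)
Lemma C1_radial phi : C1 phi -> radial_derive (@dil R) phi
  (fun x => x.1 * dx phi x + x.2 * dy phi x).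
Proof.
move=> [d1 d2 c1 c2].
exists (fun x t => x.1 * dx phi (dil t x) + x.2 * dy phi (dil t x)); split.
- move=> x t; apply: is_derive_cvg.
  pose B h := h^-1 * (phi (t * x.1, (h + t) * x.2) - phi (t * x.1, t * x.2)).
  pose A h := h^-1 * (phi ((h + t) * x.1, (h + t) * x.2) - phi (t * x.1, (h + t) * x.2)).
  have -> : (fun h => h^-1 * (phi (dil (h + t) x) - phi (dil t x))) = A \+ B.
    by apply/funext => h; rewrite /A /B /dil/=; ring.
  apply: cvgD; last first.
    apply: (@is_derive_cvgP (fun s => phi (t * x.1, s * x.2))).
    have := @is_derive_dy phi (t * x.1, t * x.2) (d2 _).
    exact: is_derive_scale.
  have C : dx phi (p.1 * x.1, p.2 * x.2) @[p --> (t, t)] --> dx phi (t * x.1, t * x.2).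
    exact: (cvg_comp _ _ (@continuous_scale_pair x (t, t)) (c1 _)).
  have C' : x.1 * dx phi (p.1 * x.1, p.2 * x.2) @[p --> (t, t)] -->
      x.1 * dx phi (dil t x) by apply: cvgM => //; exact: cvg_cst.
  apply/cvgrPdist_lt => e e0.
  move/cvgrPdist_lt : C' => /(_ e e0) /nbhs_ballP[del /= del0 Hdel].
  near=> h.
  have h0 : h != 0 by near: h; exact: nbhs_dnbhs_neq.
  have hdel : `|h| < del.
    near: h; apply: dnbhs0_lt => //.
  have dA (s : R) : is_derive s 1 (fun s => phi (s * x.1, (h + t) * x.2))
      (x.1 * dx phi (s * x.1, (h + t) * x.2)).
    have := @is_derive_dx phi (s * x.1, (h + t) * x.2) (d1 _).
    exact: is_derive_scale.
  have cA a b : {within `[a, b], continuous (fun s => phi (s * x.1, (h + t) * x.2))}.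
    apply: continuous_subspaceT => s.
    by apply/differentiable_continuous/derivable1_diffP; case: (dA s).
  have [xi xih ->] : exists2 xi, `|t - xi| < del &
      A h = x.1 * dx phi (xi * x.1, (h + t) * x.2).
    move: hdel; have [hp|hn|h00] := ltgtP h 0.
    - rewrite ltr0_norm// => hdel.
      have [|xi + E] := @MVT R _ _ (h + t) t _ (fun s _ => dA s) (cA _ _); first by lra.
      rewrite in_itv/= => /andP[x1 x2]; exists xi.
        by rewrite ger0_norm; lra.
      rewrite /A -[in LHS](opprB (phi (t * _, _))) E; field.
      by rewrite lt_eqF.
    - rewrite gtr0_norm// => hdel.
      have [|xi + E] := @MVT R _ _ t (h + t) _ (fun s _ => dA s) (cA _ _); first by lra.
      rewrite in_itv/= => /andP[x1 x2]; exists xi.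
        by rewrite ltr0_norm; lra.
      by rewrite /A E; field; rewrite gt_eqF.
    - by rewrite h00 eqxx in h0.
  apply: (Hdel (xi, h + t)); split => //=.
  by rewrite /ball/= opprD addrCA subrr addr0 normrN.
- move=> x t; apply: cvgD; apply: cvgM; try exact: cvg_cst.
    exact: (cvg_comp _ _ (@continuous_dil x t) (c1 _)).
  exact: (cvg_comp _ _ (@continuous_dil x t) (c2 _)).
- by move=> x t; rewrite /dil/=; ring.
Unshelve. all: by end_near.
Qed.

End C1_plane.

(** * Powers with rational exponents *)

Section rational_power.
Context (R : realType).
Variable p : nat.
Hypothesis p_odd : odd p.
Implicit Types (t : R) (n k : nat).

Let p_gt0 : (0 < p)%N. Proof. by case: p p_odd. Qed.

Let pR : p%:R != 0 :> R. Proof. by rewrite pnatr_eq0 -lt0n. Qed.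

Lemma odd_rootK t : odd_root p t ^+ p = t.
Proof.
rewrite /odd_root exprMn -[X in _ * X]powR_mulrn ?powR_ge0// -powRrM mulVf// powRr1//.
have [->|t0] := eqVneq t 0; first by rewrite normr0 mulr0.
have -> : Num.sg t ^+ p = Num.sg t.
  rewrite -(odd_double_half p) p_odd exprS -mul2n exprM sqr_sg t0 expr1n.
  by rewrite mulr1.
by rewrite -numEsg.
Qed.

Lemma rat_powerD n t : rat_power (p + n) p t = t * rat_power n p t.
Proof. by rewrite /rat_power exprD odd_rootK. Qed.

Lemma rat_power_gt0 n t : 0 < t -> rat_power n p t = t `^ (n%:R / p%:R).
Proof.
move=> t0; rewrite /rat_power /odd_root gtr0_sg// mul1r gtr0_norm//.
by rewrite -powR_mulrn ?powR_ge0// -powRrM mulrC.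
Qed.

Lemma rat_powerN n t : rat_power n p (- t) = (-1) ^+ n * rat_power n p t.
Proof. by rewrite /rat_power /odd_root sgrN normrN mulNr -[in LHS]mulN1r exprMn. Qed.

Lemma rat_power0 n : (0 < n)%N -> rat_power n p (0 : R) = 0.
Proof. by move=> n0; rewrite /rat_power /odd_root sgr0 mul0r expr0n; case: n n0. Qed.

Let derive_pos n t : 0 < t ->
  is_derive t 1 (rat_power n p) (n%:R / p%:R * t `^ (n%:R / p%:R - 1)).
Proof.
move=> t0; apply: (@near_eq_is_derive _ _ _ (fun s => s `^ (n%:R / p%:R))); last exact: is_derive1_powR.
near=> s; rewrite rat_power_gt0//; near: s; exact: lt_nbhsr.
Unshelve. all: by end_near.
Qed.

Let derive_neg n t : t < 0 -> is_derive t 1 (rat_power n p)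
  ((-1) ^+ n.+1 * (n%:R / p%:R * (- t) `^ (n%:R / p%:R - 1))).
Proof.
move=> t0; have Nt0 : 0 < - t by rewrite oppr_gt0.
have d := derive_pos n Nt0.
have dN : is_derive t 1 (fun s : R => - s) (-1).
  by apply: is_derive_eq.
have dc := @is_derive1_comp R _ (fun s => - s) t _ _ d dN.
have -> : rat_power n p = (fun s => (-1) ^+ n * ((rat_power n p) \o (fun s => - s)) s) :> (R -> R).
  by apply/funext => s; rewrite /= rat_powerN mulrA -exprD addnn -mul2n exprM sqrrN expr1n expr1n mul1r.
apply: is_derive_eq; rewrite /GRing.scale/= exprSr; ring.
Qed.

Lemma continuous_rat_power n : (0 < n)%N -> continuous (rat_power n p : R -> R).
Proof.
move=> n0 t; have [t0|t0|->] := ltgtP t 0.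
- by apply/differentiable_continuous/derivable1_diffP; case: (derive_neg n t0).
- by apply/differentiable_continuous/derivable1_diffP; case: (derive_pos n t0).
rewrite /continuous_at rat_power0//.
(* At 0 the root is small because [|s| < e^p] implies [|s|^(1/p) < e]. *)
suff r0 : odd_root p s @[s --> (0 : R)] --> (0 : R).
  have := cvg_comp _ _ r0 (@exprn_continuous R n 0).
  by rewrite expr0n; case: n n0.
apply/cvgrPdist_lt => e e0; near=> s.
rewrite sub0r normrN.
have : `|s| < e ^+ p.
  near: s; exists (e ^+ p); first exact: exprn_gt0.
  by move=> y /=; rewrite sub0r normrN.
by rewrite -{1}(odd_rootK s) normrX ltr_pXn2r ?nnegrE ?normr_ge0 ?(ltW e0).
Unshelve. all: by end_near.
Qed.

(** Off 0 this is the derivative of a real power, extended by parity. At 0 the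
    difference quotient is [rat_power k p], by [rat_powerD], and tends to 0. *)
Lemma is_derive_rat_power k t : (0 < k)%N ->
  is_derive t 1 (rat_power (p + k) p) ((p + k)%:R / p%:R * rat_power k p t).
Proof.
move=> k0; have E : (p + k)%:R / p%:R - 1 = k%:R / p%:R :> R.
  by rewrite natrD; field.
have [t0|t0|->] := ltgtP t 0.
- have := derive_neg (p + k) t0; rewrite E -rat_power_gt0 ?oppr_gt0// rat_powerN.
  move=> d; apply: is_derive_eq; rewrite -addSn exprD exprS.
  have -> : (-1) ^+ p = -1 :> R by rewrite -signr_odd p_odd expr1.
  rewrite mulrN1 opprK mul1r mulrCA; congr (_ * _).
  by rewrite mulrA -exprD addnn -mul2n exprM sqrrN expr1n expr1n mul1r.
- by have := derive_pos (p + k) t0; rewrite E rat_power_gt0.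
- rewrite rat_power0// mulr0; apply: is_derive_cvg.
  have c := @continuous_rat_power k k0 (0 : R).
  rewrite /continuous_at rat_power0// in c.
  have c' : rat_power k p h @[h --> (0 : R)^'] --> (0 : R) by exact: cvg_within_filter c.
  apply: cvg_trans c'; apply: near_eq_cvg; near=> h.
  have h0 : h != 0 by near: h; exact: nbhs_dnbhs_neq.
  by rewrite addr0 rat_power0 ?addn_gt0 ?k0 ?orbT// subr0 rat_powerD mulKf.
Unshelve. all: by end_near.
Qed.

End rational_power.

(** * The Pohozaev identity *)

Section pohozaev.
Context (R : realType).
Notation mu := (leb2 R).
Notation radial := (radial_derive (@dil R)).
Implicit Types (phi psi g h D E : plane R -> R) (x : plane R).

Lemma leb2_sigma_finite : sigma_finite setT mu.
Proof.
have /sigma_finiteP[F [TF ndF Foo]] := sigma_finiteT (@lebesgue_measure R).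
exists (fun n => F n `*` F n).
  apply/esym; rewrite -subTset => -[x y] _.
  have : [set: measurableTypeR R] x by []. rewrite TF => -[n _ Fx].
  have : [set: measurableTypeR R] y by []. rewrite TF => -[k _ Fy].
  exists (maxn n k) => //; split.
    by move: Fx; apply/subsetPset/ndF/leq_maxl.
  by move: Fy; apply/subsetPset/ndF/leq_maxr.
move=> k; have [mF Fk] := Foo k; split; first exact: measurableX.
by rewrite product_measure1E// lte_mul_pinfty// ge0_fin_numE.
Qed.

(** The product measure as a sigma-finite measure, in order to form its product
    with the measure of the dilation parameter. *)
Definition leb2_sf : {sigma_finite_measure set (plane R) -> \bar R} :=
  HB.pack (leb2 R) (Measure_isSigmaFinite.Build _ _ _ (leb2 R) leb2_sigma_finite).

Lemma dilation_int psi E : L1 mu psi -> L1 mu E -> radial psi E ->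
  \int[mu]_x E x = - 2 * \int[mu]_x psi x.
Proof.
exact: (@radial_int _ _ R leb2_sf (@dil R) (@measurable_dil2 R)
  (fun t K t0 => @L1_dil R t t0 K) (fun t K t0 => @int_dil R t t0 K)).
Qed.

Lemma dilation_L2 psi E (a b : R) : L2 mu psi -> L2 mu E -> radial psi E ->
  0 < a -> a <= b ->
  nsq mu (fun x => psi (dil b x) - psi (dil a x)) <=
    (b - a) ^+ 2 * a^-1 ^+ 4 * nsq mu E.
Proof.
exact: (@radial_L2 _ _ R leb2_sf (@dil R) (@measurable_dil2 R)
  (fun t K t0 => @L1_dil R t t0 K) (fun t K t0 => @int_dil R t t0 K)).
Qed.

Lemma radial_comp (G G' : R -> R) phi D :
  (forall y : R, is_derive y 1 G (G' y)) -> continuous G' -> radial phi D ->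
  radial (G \o phi) (fun x => G' (phi x) * D x).
Proof.
move=> dG cG' [e [de ce eD]]; exists (fun x t => G' (phi (dil t x)) * e x t); split.
- move=> x t; exact: (@is_derive1_comp R G _ t _ _ (dG _) (de x t)).
- move=> x t; apply: cvgM; last exact: ce.
  apply: (@continuous_comp _ _ _ (fun t => phi (dil t x)) G'); last exact: cG'.
  by apply/differentiable_continuous/derivable1_diffP; case: (de x t).
- by move=> x t; rewrite mulrCA eD.
Qed.

(** The difference quotients of [c |-> phi (c x)] at 1 are bounded in L^2 by
    [dilation_L2] and converge pointwise, hence they converge weakly. *)
Lemma dilation_weak_derive g phi D (h_ : nat -> R) :
  L2 mu g -> L2 mu phi -> L2 mu D -> radial phi D ->
  (forall n, h_ n != 0) -> (forall n, `|h_ n| <= 2^-1) ->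
  (h_ n @[n --> \oo] --> (0 : R)) ->
  (h_ n)^-1 * (ip mu g (phi \o dil (1 + h_ n)) - ip mu g phi) @[n --> \oo] --> ip mu g D.
Proof.
move=> Lg Lphi LD rad hn0 hhalf hc.
have pos n : 0 < 1 + h_ n by have := hhalf n; rewrite ler_norml => /andP[]; lra.
pose q n x := (h_ n)^-1 * (phi (dil (1 + h_ n) x) - phi x).
have Ld n : L2 mu (fun x => phi (dil (1 + h_ n) x) - phi x).
  exact: (L2B (L2_dil (pos n) Lphi) Lphi).
have Lq n : L2 mu (q n) by exact: L2Z.
have d1 : phi \o dil 1 = phi by apply/funext => x; rewrite /= dil1.
(* Since [1 + h_ n >= 1/2], the factor [a^-4] of [dilation_L2] is at most 16. *)
have bound n : nsq mu (q n) <= 16 * nsq mu D.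
  rewrite /q (nsqZ _ (Ld n)).
  have hn2 : 0 < h_ n ^+ 2 by rewrite exprn_even_gt0//= hn0.
  rewrite exprVn ler_pdivrMl//.
  have [hneg|hpos] := ltP (h_ n) 0.
    rewrite nsqBC; have := dilation_L2 Lphi LD rad (pos n) (b := 1).
    rewrite (_ : (fun x => phi (dil 1 x) - _) = fun x => phi x - phi (dil (1 + h_ n) x)); last first.
      by apply/funext => x; rewrite dil1.
    move=> H; have {H} := H _; rewrite gerDl ltW// => /(_ isT)/le_trans; apply.
    rewrite [leRHS]mulrA ler_wpM2r ?nsq_ge0// opprD addrA subrr sub0r sqrrN.
    rewrite ler_wpM2l ?sqr_ge0// exprVn.
    rewrite -[leRHS]invrK lef_pV2 ?posrE ?exprn_gt0 ?invr_gt0//.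
    rewrite (_ : 16^-1 = 2^-1 ^+ 4 :> R); last by field.
    rewrite lerXn2r ?nnegrE ?(ltW (pos n))//.
    by have := hhalf n; rewrite ler_norml => /andP[]; lra.
  have := dilation_L2 Lphi LD rad ltr01 (b := 1 + h_ n).
  rewrite (_ : (fun x => _ - phi (dil 1 x)) = fun x => phi (dil (1 + h_ n) x) - phi x); last first.
    by apply/funext => x; rewrite dil1.
  move=> H; have {H} := H _; rewrite lerDl => /(_ hpos)/le_trans; apply.
  rewrite addrAC subrr add0r invr1 expr1n mulr1 [leRHS]mulrA ler_wpM2r ?nsq_ge0//.
  by rewrite ler_peMr ?sqr_ge0//; lra.
have pt x : q n x @[n --> \oo] --> D x.
  have [e [de ce eD]] := rad.
  have := is_derive_cvgP (de x 1).
  rewrite -(mul1r (e x 1)) eD dil1 => H.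
  have h0 : h_ n @[n --> \oo] --> (0 : R)^'.
    move=> A [del /= del0 HA]; have /cvgrPdist_lt/(_ _ del0) := hc.
    by apply: filterS => n hn; apply: HA.
  have := cvg_comp _ _ h0 H.
  rewrite (_ : _ \o h_ = q ^~ x)//.
  by apply/funext => n; rewrite /q /= (addrC 1).
have := weak_cvg Lg Lq LD bound pt.
rewrite (_ : (fun n => ip mu g (q n)) = fun n => (h_ n)^-1 * (ip mu g (phi \o dil (1 + h_ n)) - ip mu g phi))//.
apply/funext => n; have Lt := L2_dil (pos n) Lphi.
by rewrite ipC /q (ipZl _ (Ld n) Lg) (ipBl Lt Lphi Lg) (ipC _ g) (ipC _ g).
Qed.

(** For [F c = <g, phi (c .)>], [fraclap_dil] reads
    [F (1/c) = c^(2 - 2 s) F c]. At [c = 1] the derivative of the left-hand side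
    is [- <g, D>] and that of the right-hand side [(2 - 2 s) <g, phi> + <g, D>],
    by [dilation_weak_derive]. *)
Lemma fraclap_pohozaev s phi g D : is_fraclap s phi g ->
  L2 mu phi -> L2 mu g -> L2 mu D -> radial phi D ->
  ip mu g D = - (1 - s) * ip mu g phi.
Proof.
move=> hg Lphi Lg LD rad.
pose F c := ip mu g (phi \o dil c).
pose c n : R := 1 + n.+2%:R^-1.
have n0 n : 0 < n.+2%:R^-1 :> R by rewrite invr_gt0.
have n12 n : n.+2%:R^-1 <= 2^-1 :> R by rewrite lef_pV2 ?posrE// ler_nat.
have c0 n : 0 < c n by rewrite /c addr_gt0.
have hc : n.+2%:R^-1 @[n --> \oo] --> (0 : R).
  by have := @cvg_harmonic R; rewrite -(cvg_shiftn 1); under eq_fun do rewrite /= addn1.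
(* [1 + k n] is the inverse of [c n], so that both sides are difference
   quotients of [F] at 1. *)
pose k n : R := (c n)^-1 - 1.
have hE n : n.+2%:R^-1 = c n - 1 by rewrite /c addrAC subrr add0r.
have cn0 n : c n != 0 by rewrite gt_eqF.
have kE n : k n = - (n.+2%:R^-1 / c n) by rewrite /k hE; field.
have cc : c n @[n --> \oo] --> (1 : R).
  rewrite -[X in _ --> X](addr0 (1 : R)).
  by apply: cvgD; [exact: cvg_cst|exact: hc].
have cV : (c n)^-1 @[n --> \oo] --> (1 : R).
  rewrite -[X in _ --> X](@invr1 R).
  by apply: cvgV; [exact: oner_neq0|exact: cc].
have q1 : (n.+2%:R^-1)^-1 * (F (c n) - F 1) @[n --> \oo] --> ip mu g D.
  have := dilation_weak_derive Lg Lphi LD rad (h_ := fun n => n.+2%:R^-1) _ _ hc.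
  rewrite /F (_ : phi \o dil 1 = phi); last by apply/funext => x; rewrite /= dil1.
  apply=> n; first by rewrite gt_eqF.
  by rewrite gtr0_norm.
have q2 : (k n)^-1 * (F (c n)^-1 - F 1) @[n --> \oo] --> ip mu g D.
  have kc n : 1 + k n = (c n)^-1 by rewrite /k addrC subrK.
  have := @dilation_weak_derive g phi D k Lg Lphi LD rad _ _ _.
  rewrite (_ : (fun n => (k n)^-1 * (ip mu g (phi \o dil (1 + k n)) - _)) =
    fun n => (k n)^-1 * (F (c n)^-1 - F 1)); last first.
    apply/funext => n; rewrite kc /F (_ : phi \o dil 1 = phi)//.
    by apply/funext => x; rewrite /= dil1.
  apply.
  - by move=> n; rewrite kE oppr_eq0 mulf_neq0 ?invr_eq0 ?gt_eqF.
  - move=> n; rewrite kE normrN gtr0_norm ?divr_gt0//.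
    apply: le_trans (n12 n); rewrite ler_pdivrMr// ler_peMr ?(ltW (n0 n))//.
    by rewrite /c lerDl ltW.
  - rewrite /k -[X in _ --> X](subrr (1 : R)).
    by apply: cvgB; [exact: cV|exact: cvg_cst].
have hF n : F (c n)^-1 = (c n) `^ (2 - 2 * s) * F (c n).
  rewrite /F (fraclap_dil (c0 n) hg); congr (_ * _).
  rewrite -powR_mulrn ?ltW// -(powR_inv1 (ltW (c0 n))) -powRrM mulN1r.
  by rewrite -powRD// (cn0 n) implybT.
have d : is_derive (1 : R) 1 (fun t => t `^ (2 - 2 * s)) (2 - 2 * s).
  have := is_derive1_powR (2 - 2 * s) (@ltr01 R).
  by rewrite powR1 mulr1.
have q3 : (n.+2%:R^-1)^-1 * ((c n) `^ (2 - 2 * s) - 1) @[n --> \oo] --> 2 - 2 * s.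
  have h0 : n.+2%:R^-1 @[n --> \oo] --> (0 : R)^'.
    move=> A [del /= del0 HA]; have /cvgrPdist_lt/(_ _ del0) := hc.
    by apply: filterS => n hn; apply: HA => //; rewrite gt_eqF.
  have := cvg_comp _ _ h0 (is_derive_cvgP d).
  rewrite (_ : _ \o _ = fun n => (n.+2%:R^-1)^-1 * ((c n) `^ (2 - 2 * s) - 1))//.
  by apply/funext => n; rewrite /= powR1 /c (addrC 1).
have q4 : F (c n) @[n --> \oo] --> F 1.
  have l : F 1 + n.+2%:R^-1 * ((n.+2%:R^-1)^-1 * (F (c n) - F 1)) @[n --> \oo] -->
      F 1 + 0 * ip mu g D.
    by apply: cvgD; [exact: cvg_cst|apply: cvgM; [exact: hc|exact: q1]].
  rewrite mul0r addr0 in l.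
  rewrite (_ : (fun n => F (c n)) = fun n => F 1 + n.+2%:R^-1 *
    ((n.+2%:R^-1)^-1 * (F (c n) - F 1)))//.
  by apply/funext => n; rewrite mulVKf ?gt_eqF// addrC subrK.
have q5 : (n.+2%:R^-1)^-1 * (F (c n)^-1 - F 1) @[n --> \oo] --> (2 - 2 * s) * F 1 + ip mu g D.
  have l : (n.+2%:R^-1)^-1 * ((c n) `^ (2 - 2 * s) - 1) * F (c n) +
     (n.+2%:R^-1)^-1 * (F (c n) - F 1) @[n --> \oo] --> (2 - 2 * s) * F 1 + ip mu g D.
    by apply: cvgD; [apply: cvgM; [exact: q3|exact: q4]|exact: q1].
  rewrite (_ : (fun n => _) = fun n => (n.+2%:R^-1)^-1 * ((c n) `^ (2 - 2 * s) - 1) * F (c n) +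
     (n.+2%:R^-1)^-1 * (F (c n) - F 1))//.
  by apply/funext => n; rewrite hF -mulrA -mulrDr; congr (_ * _); rewrite mulrBl mul1r addrA subrK.
have q6 : (n.+2%:R^-1)^-1 * (F (c n)^-1 - F 1) @[n --> \oo] --> -1 * ip mu g D.
  have l : - (c n)^-1 * ((k n)^-1 * (F (c n)^-1 - F 1)) @[n --> \oo] --> -1 * ip mu g D.
    by apply: cvgM; [exact: cvgN cV|exact: q2].
  rewrite (_ : (fun n => _) = fun n => - (c n)^-1 * ((k n)^-1 * (F (c n)^-1 - F 1)))//.
  apply/funext => n; rewrite mulrA kE; congr (_ * _).
  have := cn0 n; have : n.+2%:R != 0 :> R by [].
  by move: (c n) (n.+2%:R) => x y y0 x0; field; rewrite x0 y0.
have F1 : F 1 = ip mu g phi.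
  by rewrite /F (_ : phi \o dil 1 = phi)//; apply/funext => x; rewrite /= dil1.
have : (2 - 2 * s) * F 1 + ip mu g D = -1 * ip mu g D.
  by apply: (cvg_unique _ q5 q6); exact: Rhausdorff.
by rewrite F1; lra.
Qed.

End pohozaev.

(** * The theorem *)

Section solution.
Context (R : realType).
Notation mu := (leb2 R).
Implicit Types (phi u v f g h D : plane R -> R).

Lemma L2_ae f g : measurable_fun setT f -> {ae mu, forall x, f x = g x} ->
  L2 mu g -> L2 mu f.
Proof.
move=> mf fg [mg Ig]; split=> //.
have mf2 : measurable_fun setT (EFin \o (fun x => f x ^+ 2)).
  exact/measurable_EFinP/measurable_funX.
apply/integrableP; split=> //.
have /integrableP[mg2] := Ig; apply: le_lt_trans.
rewrite le_eqVlt; apply/orP; left; apply/eqP; apply: ae_eq_integral => //.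
- exact: measurableT_comp.
- exact: measurableT_comp.
- by apply: filterS fg => x fgx _; rewrite /= fgx.
Qed.

Lemma fraclapP s u : fraclap_dom s u -> is_fraclap s u (fraclap s u).
Proof. by move=> [g hg]; exact: (@xgetPex _ (cst 0) [set g | is_fraclap s u g] (ex_intro _ g hg)). Qed.

Lemma is_fraclap_L2 s u g : is_fraclap s u g -> L2 mu u /\ L2 mu g.
Proof. by move=> [a [b [/is_fourierP[[Lu _ _]] _ _ _ _ /is_fourierP[[Lg _ _]] _ _ _ _]]]. Qed.

(** Testing a linear relation that holds almost everywhere against [v]. *)
Lemma ip_lin3 (a b c : R) f g h v : L2 mu f -> L2 mu g -> L2 mu h -> L2 mu v ->
  {ae mu, forall x, a * f x + b * g x + c * h x = 0} ->
  a * ip mu f v + b * ip mu g v + c * ip mu h v = 0.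
Proof.
move=> Lf Lg Lh Lv e.
have La := L2Z a Lf; have Lb := L2Z b Lg; have Lc := L2Z c Lh.
rewrite -(ipZl a Lf Lv) -(ipZl b Lg Lv) -(ipZl c Lh Lv).
rewrite -(ipDl La Lb Lv) -(ipDl (L2D La Lb) Lc Lv).
have [mv _] := Lv; have [ml _] := L2D (L2D La Lb) Lc.
transitivity (\int[mu]_x (0 : R)).
  apply: int_ae => //; first exact: measurable_funM.
  by apply: filterS e => x ->; rewrite mul0r.
by rewrite /Rintegral integral0.
Qed.

(** Testing the equation with [phi] and with [x . grad phi] gives two linear
    equations for [B] and [P], of determinant [- nu1 nu2 K / (m (m + 1))]; [K]
    vanishes at the critical exponent. *)
Lemma virial_system (s c m nu1 nu2 A B P K : R) :
  m != 0 -> m + 1 != 0 -> nu1 != 0 -> nu2 != 0 ->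
  K = 2 - (1 - s) * (m + 1) -> K != 0 ->
  - c * A + nu1 * B + nu2 / m * P = 0 ->
  - c * - A + nu1 * (- (1 - s) * B) + nu2 / m * (- 2 / (m + 1) * P) = 0 ->
  B = - (c * (m - 1) / (nu1 * K)) * A /\
  P = s * c * m * (m + 1) / (nu2 * K) * A.
Proof.
move=> m0 m1 n1 n2 KE K0 e1 e2.
have hP : P = m / nu2 * (c * A - nu1 * B).
  have -> : c * A - nu1 * B = nu2 / m * P by rewrite -[LHS]addr0 -e1; ring.
  by field; rewrite n2 m0.
have hB : B = - (c * (m - 1) / (nu1 * K)) * A.
  have E : nu1 * K * B = - (c * (m - 1)) * A.
    have : (m + 1) * (- c * - A + nu1 * (- (1 - s) * B) + nu2 / m * (- 2 / (m + 1) * P)) = 0.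
      by rewrite e2 mulr0.
    rewrite hP (_ : (m + 1) * _ = c * (m - 1) * A + nu1 * K * B); last first.
      by rewrite KE; field; rewrite n2 m0 m1.
    by move=> h; rewrite -[LHS]addr0 -(oppr0 R) -h; ring.
  have n1K : nu1 * K != 0 by rewrite mulf_neq0.
  by apply: (mulfI n1K); rewrite E; field; rewrite n1 K0.
split=> //; rewrite hP hB.
have -> : s * c * m * (m + 1) = c * m * (K + m - 1) by rewrite KE; ring.
by field; rewrite n1 n2 K0.
Qed.

End solution.

Theorem lemma2p2 (R : realType) (s c m nu1 nu2 : R) (k p : nat)
    (phi : plane R -> R)
    (hs : 0 < s < 1) (hc : c != 0)
    (hm : 1 < m) (hm_crit : m != (1 + s) / (1 - s))
    (hm_pow : m - 1 = k%:R / p%:R) (hkp : coprime k p) (hp : odd p)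
    (hnu1 : nu1 != 0) (hnu2 : nu2 = 1 \/ nu2 = -1)
    (hreg : smooth_vanishing s phi)
    (hsol : is_solution s c nu1 nu2 m k p phi) :
  [/\ L2norm (fraclap (s / 2) phi) ^+ 2
        = - (c * (m - 1) / (nu1 * (2 - (1 - s) * (m + 1)))) * L2norm phi ^+ 2,
      \int[leb2 R]_x (rat_power (2 * p + k) p (phi x))
        = s * c * m * (m + 1) / (nu2 * (2 - (1 - s) * (m + 1)))
          * L2norm phi ^+ 2 &
      nu1 = -1 -> nu2 = 1 ->
        let r_c := 1 - 2 * s / (m - 1) in
        energy s nu1 nu2 m k p phi
          = r_c * (c * (m - 1) / (2 * (2 - (1 - s) * (m + 1))))
            * L2norm phi ^+ 2].
Proof.
have /andP[s0 s1] := hs.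
have p0 : (0 < p)%N by exact: odd_gt0.
have pR : p%:R != 0 :> R by rewrite pnatr_eq0 -lt0n.
have n2 : nu2 != 0 by case: hnu2 => ->; rewrite ?oppr_eq0 oner_neq0.
have m0 : m != 0 by rewrite gt_eqF//; lra.
have m10 : m + 1 != 0 by rewrite gt_eqF//; lra.
set K := 2 - (1 - s) * (m + 1).
have K0 : K != 0.
  apply: contra hm_crit => /eqP K0; apply/eqP.
  have s10 : 1 - s != 0 by rewrite gt_eqF// subr_gt0.
  apply: (mulfI s10); rewrite mulrCA mulfV// mulr1.
  by move: K0; rewrite /K => K0; lra.
have [C1phi Ldx Ldy dom1 dom2] := hreg.
pose g := fraclap s phi; pose h := fraclap (s / 2) phi.
have fg : is_fraclap s phi g := fraclapP dom1.
have fh : is_fraclap (s / 2) phi h := fraclapP dom2.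
have [Lphi Lg] := is_fraclap_L2 fg; have [_ Lh] := is_fraclap_L2 fh.
have [mphi _] := Lphi.
pose D := fun x : plane R => x.1 * dx phi x + x.2 * dy phi x.
have LD : L2 (leb2 R) D := L2D (inL2P Ldx) (inL2P Ldy).
have rad := C1_radial C1phi.
pose w := fun x => rat_power (p + k) p (phi x).
have pk0 : (0 < p + k)%N by rewrite addn_gt0 p0.
have mw : measurable_fun setT w.
  apply: (measurableT_comp (f := rat_power (p + k) p)) mphi.
  exact: (continuous_measurable_fun (continuous_rat_power hp pk0)).
have sol : {ae leb2 R, forall x, - c * phi x + nu1 * g x + nu2 / m * w x = 0} := hsol.
have Lw : L2 (leb2 R) w.
  apply: (L2_ae (g := fun x => m / nu2 * (c * phi x - nu1 * g x)) mw).
    apply: filterS sol => x e; have -> : c * phi x - nu1 * g x = nu2 / m * w x.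
      by rewrite -[LHS]addr0 -e; ring.
    by field; rewrite n2 m0.
  exact: (L2Z (m / nu2) (L2B (L2Z c Lphi) (L2Z nu1 Lg))).
have powE x : rat_power (2 * p + k) p (phi x) = w x * phi x.
  by rewrite mul2n -addnn -addnA rat_powerD// mulrC.
set A := nsq (leb2 R) phi.
set P := \int[leb2 R]_x rat_power (2 * p + k) p (phi x).
have PE : P = ip (leb2 R) w phi by apply: eq_Rintegral => x _; exact: powE.
set B := nsq (leb2 R) h.
have BE : ip (leb2 R) g phi = B := fraclap_energy s0 fg fh.
have BD : ip (leb2 R) g D = - (1 - s) * B.
  by rewrite -BE; exact: fraclap_pohozaev fg Lphi Lg LD rad.
have AD : ip (leb2 R) phi D = - A.
  have dsq (y : R) : is_derive y 1 (fun y => y ^+ 2) (2 * y).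
    by apply: is_derive_eq; rewrite /GRing.scale/=; ring.
  have r2 := radial_comp dsq (@mulrl_continuous R 2) rad.
  have I2 : L1 (leb2 R) (fun x => 2 * phi x * D x) := L2M (L2Z 2 Lphi) LD.
  have := dilation_int Lphi.2 I2 r2.
  rewrite -[LHS]/(ip _ (fun x => 2 * phi x) D) (ipZl 2 Lphi LD) -(nsqE _ phi) -/A.
  by move=> E; lra.
have PD : ip (leb2 R) w D = - 2 / (m + 1) * P.
  have mE : m + 1 = (p + (p + k))%:R / p%:R :> R.
    have -> : m + 1 = k%:R / p%:R + 2 by rewrite -hm_pow; ring.
    by rewrite !natrD; field.
  have dG (y : R) : is_derive y 1 (rat_power (p + (p + k)) p)
      ((m + 1) * rat_power (p + k) p y) by rewrite mE; exact: is_derive_rat_power.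
  have cG' : continuous (fun y : R => (m + 1) * rat_power (p + k) p y).
    by move=> y; apply: cvgM; [exact: cvg_cst|exact: continuous_rat_power].
  have rP := radial_comp dG cG' rad.
  have IP : L1 (leb2 R) (fun x => rat_power (2 * p + k) p (phi x)).
    by under eq_fun do rewrite powE; exact: L2M.
  have IwD : L1 (leb2 R) (fun x => (m + 1) * w x * D x) := L2M (L2Z (m + 1) Lw) LD.
  have E2 : (2 * p + k = p + (p + k))%N by rewrite mul2n -addnn addnA.
  rewrite /P; move: IP; rewrite E2 => IP.
  have := dilation_int IP IwD rP.
  rewrite -[LHS]/(ip _ (fun x => (m + 1) * w x) D) (ipZl (m + 1) Lw LD) => E.
  by apply: (mulfI m10); rewrite E; field.
have e1 := ip_lin3 Lphi Lg Lw Lphi sol.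
rewrite -/(nsq _ _) -/A BE -PE in e1.
have e2 := ip_lin3 Lphi Lg Lw LD sol.
rewrite AD BD PD in e2.
have [hB hP] := virial_system m0 m10 hnu1 n2 erefl K0 e1 e2.
rewrite (L2normE Lphi) (L2normE Lh) -/A -/B; split=> //.
move=> n1E n2E; rewrite /energy -/P.
have -> : \int[leb2 R]_x (`|fraclap (s / 2) phi x| ^+ 2) = B.
  by rewrite /B nsqE; apply: eq_Rintegral => x _; rewrite real_normK ?num_real.
rewrite hP hB n1E n2E /= -/K.
have m11 : m - 1 != 0 by rewrite gt_eqF// subr_gt0.
move: (A) K K0 => A' K' K0'.
by field; rewrite K0' m11 m0 m10.
Qed.
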